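(* Let $K$ be a field, $S=K[x_1,\ldots,x_n]$, and let $d\ge 1$ and $a_1,\ldots,a_n$ be nonnegative integers with $d\geq a_1\geq a_2\geq\cdots\geq a_n$ and $\sum_{i=1}^n a_i\geq d$. Let $I=I_{d;a_1,\ldots,a_n}\subset S$ be the corresponding ideal of Veronese type, and let $m=\max\{\max(u): u\in G(\sqrt I)\}$ and $b=\max\{\deg(u): u\in G(\sqrt I)\}$. Then the following are equivalent: (a) $I$ is equidimensional; (b) $\sqrt I$ is Cohen-Macaulay; (c) there is a unique Borel generator of degree $b$ of $\sqrt I$, namely $x_{m-b+1}\cdots x_m$, and for every $u\in G(\sqrt I)$ one has $\max(u)-\deg(u)\leq m-b$. Moreover, if $I$ is equidimensional, then every minimal vertex cover of $I$ has cardinality $m-b+1$.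
   Context: The ideal of Veronese type $I_{d;a_1,\ldots,a_n}\subset S$ is the ideal generated by all monomials $x_1^{u_1}\cdots x_n^{u_n}$ with $u_1+\cdots+u_n=d$ and $0\leq u_i\leq a_i$ for all $i$. For a monomial ideal $J$, $G(J)$ is its unique minimal set of monomial generators. For a monomial $u\neq 1$, $\max(u)=\max\{i : x_i \text{ divides } u\}$. An ideal $J$ of $S$ is equidimensional if $\dim(S/\mathfrak p)$ is the same number for all minimal primes $\mathfrak p$ of $J$. An ideal $J$ is called Cohen-Macaulay if $S/J$ is a Cohen-Macaulay ring. A vertex cover of a monomial ideal $J$ is a subset $W\subseteq\{x_1,\ldots,x_n\}$ such that every $u\in G(J)$ is divisible by some $x_i\in W$; it is minimal if no proper subset of $W$ is a vertex cover of $J$. A squarefree monomial ideal $J$ is squarefree strongly stable if for all $u\in G(J)$, all $j$ with $x_j\mid u$ and all $l<j$ with $x_l\nmid u$, one has $u\,x_l/x_j\in J$. The ideal $\sqrt I$ is squarefree strongly stable. The set of Borel generators of a squarefree strongly stable ideal $J$ is the (unique) minimal subset $\mathrm{Bor}(J)$ of $G(J)$ such that $J$ is the smallest squarefree strongly stable ideal containing $\mathrm{Bor}(J)$. *)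

(* Defs.v *)
From HB Require Import structures.
From mathcomp Require Import all_boot all_order all_algebra.
From mathcomp Require Import generic_quotient ring_quotient ring mpoly.
From mathcomp.classical Require Import boolp.

Set Implicit Arguments.
Unset Strict Implicit.
Unset Printing Implicit Defensive.

Import GRing.Theory.

Local Open Scope ring_scope.
Local Open Scope quotient_scope.

(** Ideals are either [Prop]-valued predicates, or elements of the types
    [idealr R] and [prime_idealr R] of ring_quotient, which are bundled boolean
    predicates. Classically the latter are exactly the proper ideals and the
    prime ideals of [R]. *)

(** * Localization of a commutative ring at a prime ideal *)

Module Localization.
Section Localization.
Variables (R : comNzRingType) (p : prime_idealr R).

Inductive fracs := Fracs { pair_of :> R * R; _ : pair_of.2 \notin p }.

#[export]
HB.instance Definition _ := [isSub for pair_of].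
#[export]
HB.instance Definition _ := [Choice of fracs by <:].

Implicit Types x y z : fracs.

Lemma denP x : x.2 \notin p. Proof. by case: x. Qed.

Lemma den1 : 1 \notin p. Proof. by rewrite idealr1. Qed.

Lemma denM s t : s \notin p -> t \notin p -> s * t \notin p.
Proof. by move=> ps pt; rewrite prime_idealrM negb_or ps. Qed.

(* [R] may have zero divisors, hence the factor [t]. *)
Definition equiv x y : bool :=
  `[< exists2 t : R, t \notin p & t * (x.1 * y.2) = t * (y.1 * x.2) >].

Lemma equiv_refl : reflexive equiv.
Proof. by move=> x; apply/asboolP; exists 1; first exact: den1. Qed.

Lemma equiv_sym : ssrbool.symmetric equiv.
Proof.
by move=> x y; apply/asboolP/asboolP => -[t pt e]; exists t.
Qed.

Lemma equiv_trans : transitive equiv.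
Proof.
move=> y x z /asboolP[t pt exy] /asboolP[u pu eyz]; apply/asboolP.
exists (t * u * y.2); first by rewrite !denM // denP.
have -> : t * u * y.2 * (x.1 * z.2) = t * (x.1 * y.2) * (u * z.2) by ring.
have -> : t * u * y.2 * (z.1 * x.2) = u * (z.1 * y.2) * (t * x.2) by ring.
rewrite exy -eyz; ring.
Qed.

Canonical equiv_equiv := EquivRel equiv equiv_refl equiv_sym equiv_trans.
Canonical equiv_encModRel := defaultEncModRel equiv.

Definition type := {eq_quot equiv}.

#[export]
HB.instance Definition _ : EqQuotient _ equiv type := EqQuotient.on type.
#[export]
HB.instance Definition _ := Choice.on type.

Definition of_ring (a : R) : fracs := @Fracs (a, 1) den1.
Definition oppf x : fracs := @Fracs (- x.1, x.2) (denP x).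
Definition addf x y : fracs :=
  @Fracs (x.1 * y.2 + y.1 * x.2, x.2 * y.2) (denM (denP x) (denP y)).
Definition mulf x y : fracs :=
  @Fracs (x.1 * y.1, x.2 * y.2) (denM (denP x) (denP y)).

Definition zero : type := \pi_type (of_ring 0).
Definition one : type := \pi_type (of_ring 1).
Definition opp := lift_op1 type oppf.
Definition add := lift_op2 type addf.
Definition mul := lift_op2 type mulf.

Lemma piP x y : reflect
  (exists2 t : R, t \notin p & t * (x.1 * y.2) = t * (y.1 * x.2))
  (\pi_type x == \pi_type y).
Proof. by rewrite eqmodE; exact: asboolP. Qed.

Lemma repr_piP x : exists2 t : R, t \notin p &
  t * ((repr (\pi_type x)).1 * x.2) = t * (x.1 * (repr (\pi_type x)).2).
Proof. by apply/piP; rewrite reprK. Qed.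

Lemma opp_pi x : opp (\pi_type x) = \pi_type (oppf x).
Proof.
unlock opp; apply/eqP/piP => /=; have [t pt e] := repr_piP x; exists t => //.
by rewrite !mulNr !mulrN e.
Qed.

Lemma add_pi x y : add (\pi_type x) (\pi_type y) = \pi_type (addf x y).
Proof.
unlock add; apply/eqP/piP => /=.
have [t pt ex] := repr_piP x; have [u pu ey] := repr_piP y.
move: (repr (\pi x)) (repr (\pi y)) ex ey => x' y' ex ey.
exists (t * u); first exact: denM.
have -> : t * u * ((x'.1 * y'.2 + y'.1 * x'.2) * (x.2 * y.2)) =
  t * (x'.1 * x.2) * (u * y'.2 * y.2) + u * (y'.1 * y.2) * (t * x'.2 * x.2)
  by ring.
rewrite ex ey; ring.
Qed.

Lemma mul_pi x y : mul (\pi_type x) (\pi_type y) = \pi_type (mulf x y).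
Proof.
unlock mul; apply/eqP/piP => /=.
have [t pt ex] := repr_piP x; have [u pu ey] := repr_piP y.
move: (repr (\pi x)) (repr (\pi y)) ex ey => x' y' ex ey.
exists (t * u); first exact: denM.
have -> : t * u * (x'.1 * y'.1 * (x.2 * y.2)) =
  t * (x'.1 * x.2) * (u * (y'.1 * y.2)) by ring.
rewrite ex ey; ring.
Qed.

Lemma pi_inj x y : x.1 * y.2 = y.1 * x.2 -> \pi_type x = \pi_type y.
Proof.
by move=> e; apply/eqP/piP; exists 1; [exact: den1 | rewrite e].
Qed.

Lemma addA : associative add.
Proof.
elim/quotW=> x; elim/quotW=> y; elim/quotW=> z.
by rewrite !add_pi; apply: pi_inj => /=; ring.
Qed.

Lemma addC : commutative add.
Proof.
elim/quotW=> x; elim/quotW=> y.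
by rewrite !add_pi; apply: pi_inj => /=; ring.
Qed.

Lemma add0 : left_id zero add.
Proof. by elim/quotW=> x; rewrite add_pi; apply: pi_inj => /=; ring. Qed.

Lemma addN : left_inverse zero opp add.
Proof.
by elim/quotW=> x; rewrite opp_pi add_pi; apply: pi_inj => /=; ring.
Qed.

#[export]
HB.instance Definition _ := GRing.isZmodule.Build type addA addC add0 addN.

Lemma mulA : associative mul.
Proof.
elim/quotW=> x; elim/quotW=> y; elim/quotW=> z.
by rewrite !mul_pi; apply: pi_inj => /=; ring.
Qed.

Lemma mulC : commutative mul.
Proof.
elim/quotW=> x; elim/quotW=> y.
by rewrite !mul_pi; apply: pi_inj => /=; ring.
Qed.

Lemma mul1 : left_id one mul.
Proof. by elim/quotW=> x; rewrite mul_pi; apply: pi_inj => /=; ring. Qed.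

Lemma mulDl : left_distributive mul add.
Proof.
elim/quotW=> x; elim/quotW=> y; elim/quotW=> z.
by rewrite !(add_pi, mul_pi); apply: pi_inj => /=; ring.
Qed.

Lemma one_neq0 : one != zero.
Proof.
apply/piP => -[t pt] /=; rewrite !(mulr1, mulr0) => t0.
by move: pt; rewrite t0 idealr0.
Qed.

#[export]
HB.instance Definition _ :=
  GRing.Zmodule_isComNzRing.Build type mulA mulC mul1 mulDl one_neq0.

End Localization.
Module Exports. HB.reexport. End Exports.
End Localization.
Export Localization.Exports.

Notation localization := Localization.type.

(** * Commutative algebra *)

Section CommutativeAlgebra.
Variable R : comNzRingType.
Implicit Types (G J : R -> Prop) (M N : idealr R) (p q : prime_idealr R).

Definition ideal_gen G : R -> Prop := fun f =>
  exists2 s : seq (R * R), (forall x, x \in s -> G x.2) &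
    f = \sum_(x <- s) x.1 * x.2.

Definition radical J : R -> Prop := fun f => exists k : nat, J (f ^+ k).

Definition noetherian : Prop :=
  forall M, exists s : seq R,
    forall f, f \in M <-> ideal_gen (fun g => g \in s) f.

Definition maximal_ideal M : Prop :=
  forall N, {subset M <= N} -> {subset N <= M}.

Definition minimal_prime J p : Prop :=
  (forall f, J f -> f \in p) /\
  forall q, (forall f, J f -> f \in q) -> {subset q <= p} -> {subset p <= q}.

Definition prime_chain (k : nat) (P : nat -> prime_idealr R) : Prop :=
  forall i, (i < k)%N ->
    {subset P i <= P i.+1} /\ ~ {subset P i.+1 <= P i}.

(* [krull_dim k] : the ring has finite Krull dimension [k]. *)
Definition krull_dim (k : nat) : Prop :=
  (exists P, prime_chain k P) /\
  forall l P, prime_chain l P -> (l <= k)%N.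

Definition regular_sequence (s : seq R) : Prop :=
  (forall i, (i < size s)%N -> forall f,
     ideal_gen (fun g => g \in take i s) (s`_i * f) ->
     ideal_gen (fun g => g \in take i s) f) /\
  ~ ideal_gen (fun g => g \in s) 1.

(* [depth M k] : the regular sequences in [M] have maximal length [k]. *)
Definition depth M (k : nat) : Prop :=
  (exists s, [/\ regular_sequence s, {subset s <= M} & size s = k]) /\
  forall s, regular_sequence s -> {subset s <= M} -> (size s <= k)%N.

(* The quantification over [M] only names the maximal ideal of the local ring
   [R]. *)
Definition cohen_macaulay_local : Prop :=
  forall M, maximal_ideal M -> exists k, depth M k /\ krull_dim k.

End CommutativeAlgebra.

(* Maximal ideals are prime, so [p] ranges over all the maximal ideals of [R]. *)
Definition cohen_macaulay_ring (R : comNzRingType) : Prop :=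
  noetherian R /\
  forall p : prime_idealr R,
    maximal_ideal p -> cohen_macaulay_local (localization p).

Section Ideals.
Variable R : comNzRingType.
Implicit Types J : R -> Prop.

Definition equidimensional J : Prop :=
  exists k : nat, forall p : prime_idealr R,
    minimal_prime J p -> krull_dim {ideal_quot p} k.

(* [M] is the proper ideal [J] in the form required by [{ideal_quot M}]. *)
Definition cohen_macaulay_ideal J : Prop :=
  exists2 M : idealr R, (forall f, f \in M <-> J f) &
    cohen_macaulay_ring {ideal_quot M}.

End Ideals.

(** * Monomial ideals *)

Definition is_max (P : nat -> Prop) (k : nat) : Prop :=
  P k /\ forall l, P l -> (l <= k)%N.

Section Monomial.
Variables (K : fieldType) (n : nat).
Local Notation S := {mpoly K[n]}.
Implicit Types (J : S -> Prop) (U V B : 'X_{1..n} -> Prop) (u v : 'X_{1..n}).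
Implicit Types W : {set 'I_n}.

Definition monomial_ideal U : S -> Prop :=
  ideal_gen (fun f => exists2 u, U u & f = 'X_[u]).

Definition veronese_ideal (d : nat) (a : 'I_n -> nat) : S -> Prop :=
  monomial_ideal (fun u => mdeg u = d /\ forall i, (u i <= a i)%N).

Definition minimal_generating_set J U : Prop :=
  (forall f, J f <-> monomial_ideal U f) /\
  forall V, (forall u, V u -> U u) ->
    (forall f, J f <-> monomial_ideal V f) -> forall u, U u -> V u.

(* For a monomial ideal [J] there is exactly one such [U], and [mingens J] is
   that set, usually written G(J). *)
Definition mingens J : 'X_{1..n} -> Prop := fun u =>
  exists2 U, minimal_generating_set J U & U u.

(* The variables are indexed by [0, ..., n - 1], hence [i.+1]: the value of
   [max_var u] is the customary max(u), where variables are x_1, ..., x_n. *)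
Definition max_var u : nat := \max_(i < n | (0 < u i)%N) i.+1.

Definition vertex_cover J W : Prop :=
  forall u, mingens J u -> exists2 i, i \in W & (0 < u i)%N.

Definition minimal_vertex_cover J W : Prop :=
  vertex_cover J W /\
  forall W' : {set 'I_n}, W' \proper W -> ~ vertex_cover J W'.

Definition squarefree_monomial_ideal J : Prop :=
  exists2 U, (forall u, U u -> forall i, (u i <= 1)%N) &
    forall f, J f <-> monomial_ideal U f.

(* Since x_j divides u, the truncated difference below is the exact exponent of
   u x_l / x_j. *)
Definition squarefree_strongly_stable J : Prop :=
  squarefree_monomial_ideal J /\
  forall u, mingens J u -> forall j l : 'I_n,
    (0 < u j)%N -> (l < j)%N -> u l = 0%N -> J 'X_[u + U_(l) - U_(j)].

Definition smallest_squarefree_strongly_stable B J : Prop :=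
  [/\ squarefree_strongly_stable J, forall u, B u -> J 'X_[u] &
      forall L : S -> Prop, squarefree_strongly_stable L ->
        (forall u, B u -> L 'X_[u]) -> forall f, J f -> L f].

Definition minimal_borel_set J B : Prop :=
  [/\ forall u, B u -> mingens J u, smallest_squarefree_strongly_stable B J &
      forall B' : 'X_{1..n} -> Prop, (forall u, B' u -> B u) ->
        smallest_squarefree_strongly_stable B' J -> forall u, B u -> B' u].

(* As for [mingens]: the set [B] is unique when [J] is squarefree strongly
   stable. *)
Definition borel_generators J : 'X_{1..n} -> Prop := fun u =>
  exists2 B, minimal_borel_set J B & B u.

(* x_(m-b+1) ... x_m, in the numbering x_1, ..., x_n of the variables. *)
Definition interval_monomial (m b : nat) : 'X_{1..n} :=
  [multinom nat_of_bool (m - b < i.+1 <= m)%N | i < n].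

End Monomial.

Arguments monomial_ideal K {n} U _.
Arguments veronese_ideal K {n} d a _.

(* Main.v *)
Require Import Defs.
From HB Require Import structures.
From mathcomp Require Import all_boot all_order all_algebra.
From mathcomp Require Import generic_quotient ring_quotient ring zify mpoly.
From mathcomp.classical Require Import boolp.

Set Implicit Arguments.
Unset Strict Implicit.
Unset Printing Implicit Defensive.

Import GRing.Theory.

Local Open Scope ring_scope.

(* The radical [J] of [I] is the Stanley-Reisner ideal of the complex whose
   nonfaces are the sets [A] with [d <= \sum_(i in A) a i]; it is shifted because
   [a] is nonincreasing. The facets are the complements of the minimal vertex
   covers, and the minimal primes are generated by the variables outside the
   facets, so (a) says that the complex is pure.

   Pure implies Cohen-Macaulay. Let [q] be the preimage in [S] of a maximal ideal
   of the quotient. By Zariski's lemma [q] contains a monic polynomial in each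
   variable, hence also some monic [h_i] in the variable [X_i] that is divisible by
   [X_i]. If the facets have [r] elements, then e_r(h), ..., e_1(h), with e_k the
   elementary symmetric functions, is a regular sequence modulo [J]: the exact
   sequence relating [J], [J : X_i] and [J + X_i] reduces this to simplices by
   vertex decomposition, and the same sequence for [h_i] removes one variable of a
   simplex, because e_k is the product of the [h_i] when only k of them are left.
   On the other hand [r] bounds the length of chains of primes above [J], because
   [r + 1] polynomials in [r] variables are algebraically dependent.

   Cohen-Macaulay implies pure. At the origin, a regular sequence yields a chain of
   primes of the same length starting at any given associated prime, so the depth
   is at most the size of every facet, whereas the dimension is at least that size.

   Condition (c) is purity read off the minimal nonfaces: a minimal nonface without
   its last element is a face, and the facets containing it can only add elements
   after the removed one. *)

(** The maximal ideal q need not contain the variables, and its residue field may be a proper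
    extension of K, so that no translation moves q to the origin. The polynomials h_i stand in for
    the variables: they lie in q, hence so do their elementary symmetric functions, and since X_i
    divides h_i, those with i outside a face F vanish modulo the prime of F. On every simplex only
    the h_i of its vertices remain.

    The same sequence must serve both ends of the exact sequence. It depends on the complex only
    through r, and J : X_i belongs to the star of i, whose facets keep r elements, whereas those of
    the link would have r - 1.

    Regularity is first taken in the weak sense that allows unit ideals; properness is checked once,
    in the local ring. Depth and dimension are compared through chains of primes alone: k regular
    elements yield k strict inclusions of primes, so a bound r on chains bounds depth and dimension
    together, and a regular sequence of length r attains both. *)

Lemma pred_eq (T : Type) (A B : T -> Prop) : (forall x, A x <-> B x) -> A = B.
Proof. by move=> e; apply/funext => x; apply/propext. Qed.

(** * Ideals and primes as predicates *)

Section Ideals.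
Variable R : comNzRingType.
Implicit Types (I J P Q T : R -> Prop) (s : seq R).

(** Unlike [idealr], this includes the unit ideal, which arises from colons and from adjoining
    elements. *)
Definition is_ideal I : Prop :=
  [/\ I 0, forall f g, I f -> I g -> I (f + g) & forall a f, I f -> I (a * f)].

Definition is_prime P : Prop :=
  [/\ is_ideal P, ~ P 1 & forall f g, P (f * g) -> P f \/ P g].

Definition is_mult_closed T : Prop := T 1 /\ forall f g, T f -> T g -> T (f * g).

Lemma is_idealN I f : is_ideal I -> I f -> I (- f).
Proof. by case=> _ _ h /(h (-1)); rewrite mulN1r. Qed.

Lemma is_idealB I f g : is_ideal I -> I f -> I g -> I (f - g).
Proof. by move=> hI hf hg; case: (hI) => _ h _; apply: h => //; exact: is_idealN. Qed.

Lemma is_idealMr I a f : is_ideal I -> I f -> I (f * a).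
Proof. by case=> _ _ h hf; rewrite mulrC; exact: h. Qed.

Lemma is_ideal_sum I (A : Type) (r : seq A) (p : pred A) (F : A -> R) :
  is_ideal I -> (forall x, p x -> I (F x)) -> I (\sum_(x <- r | p x) F x).
Proof. by case=> h0 hD _ h; apply: big_ind. Qed.

Lemma is_ideal_sum_seq I (A : eqType) (r : seq A) (F : A -> R) :
  is_ideal I -> (forall x, x \in r -> I (F x)) -> I (\sum_(x <- r) F x).
Proof. by case=> h0 hD _ h; rewrite big_seq; apply: big_ind. Qed.

Lemma is_ideal_congr I f g : is_ideal I -> I (f - g) -> I g -> I f.
Proof. by case=> _ h _ /h hfg /hfg; rewrite subrK. Qed.

Lemma is_prime_ideal P : is_prime P -> is_ideal P. Proof. by case. Qed.

Lemma is_primeX P f k : is_prime P -> P (f ^+ k) -> P f.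
Proof.
case=> hI h1 hM; elim: k => [|k IH]; first by rewrite expr0.
by rewrite exprS => /hM[].
Qed.

Lemma is_prime_prod P (A : Type) (r : seq A) (p : pred A) (F : A -> R) :
  is_prime P -> P (\prod_(x <- r | p x) F x) -> exists2 x, p x & P (F x).
Proof.
case=> hI h1 hM.
elim/big_rec: _ => [//|x y px IH /hM[Fx|/IH]]; first by exists x.
by [].
Qed.

Lemma is_prime_compl P : is_prime P -> is_mult_closed (fun f => ~ P f).
Proof. by case=> _ h1 hM; split=> // f g hf hg /hM[]. Qed.

Lemma idealr_is_ideal (M : idealr R) : is_ideal (fun f => f \in M).
Proof.
split; [exact: idealr0 | by move=> f g; exact: rpredD |].
by move=> a f; exact: idealMr.
Qed.

Lemma prime_idealr_is_prime (p : prime_idealr R) : is_prime (fun f => f \in p).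
Proof.
split; [exact: idealr_is_ideal | by rewrite idealr1 |].
by move=> f g; rewrite prime_idealrM => /orP.
Qed.

Lemma is_ideal_idealr I : is_ideal I -> ~ I 1 ->
  exists M : idealr R, forall f, f \in M <-> I f.
Proof.
move=> hI h1; pose S : R -> bool := fun f => `[< I f >].
have cl : idealr_closed S.
  split; [by apply/asboolP; case: hI | by apply/asboolP |].
  move=> a u v /asboolP hu /asboolP hv; apply/asboolP.
  by case: hI => _ hD hM; apply: hD => //; apply: hM.
pose M : idealr R := HB.pack S (isIdealr.Build R S cl).
by exists M => f; split=> /asboolP.
Qed.

Lemma is_prime_idealr P : is_prime P ->
  exists p : prime_idealr R, forall f, f \in p <-> P f.
Proof.
case=> hI h1 hM; pose S : R -> bool := fun f => `[< P f >].
have cl : idealr_closed S.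
  split; [by apply/asboolP; case: hI | by apply/asboolP |].
  move=> a u v /asboolP hu /asboolP hv; apply/asboolP.
  by case: hI => _ hD h; apply: hD => //; apply: h.
have pcl : prime_idealr_closed S.
  by move=> u v /asboolP/hM[] ?; apply/orP; [left|right]; apply/asboolP.
pose p : prime_idealr R :=
  HB.pack S (isIdealr.Build R S cl) (isPrimeIdealrClosed.Build R S pcl).
by exists p => f; split=> /asboolP.
Qed.

Lemma ideal_gen_ideal (G : R -> Prop) : is_ideal (ideal_gen G).
Proof.
split.
- by exists [::]; rewrite ?big_nil.
- move=> _ _ [s1 h1 ->] [s2 h2 ->]; exists (s1 ++ s2); last by rewrite big_cat.
  by move=> x; rewrite mem_cat => /orP[/h1|/h2].
- move=> a _ [s h ->]; exists [seq (a * x.1, x.2) | x <- s].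
    by move=> _ /mapP[x /h hx ->].
  by rewrite big_map mulr_sumr; apply: eq_bigr => x _; rewrite mulrA.
Qed.

Lemma sub_ideal_gen (G : R -> Prop) f : G f -> ideal_gen G f.
Proof.
move=> hf; exists [:: (1, f)]; last by rewrite big_seq1 mul1r.
by move=> x; rewrite inE => /eqP->.
Qed.

Lemma ideal_gen_min (G : R -> Prop) I : is_ideal I -> (forall f, G f -> I f) ->
  forall f, ideal_gen G f -> I f.
Proof.
move=> hI hG _ [s hs ->]; apply: is_ideal_sum_seq => // x /hs/hG.
by case: hI => _ _; apply.
Qed.

Definition adjoin I a : R -> Prop := fun f => exists c, I (f - c * a).

Lemma adjoin_ideal I a : is_ideal I -> is_ideal (adjoin I a).
Proof.
move=> hI; case: (hI) => h0 hD hM; split.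
- by exists 0; rewrite mul0r subr0.
- move=> f g [c hc] [d hd]; exists (c + d).
  by have := hD _ _ hc hd; congr (I _); ring.
- by move=> b f [c /(hM b) hc]; exists (b * c); move: hc; rewrite mulrBr mulrA.
Qed.

Lemma sub_adjoin I a f : I f -> adjoin I a f.
Proof. by exists 0; rewrite mul0r subr0. Qed.

Lemma mem_adjoin I a : is_ideal I -> adjoin I a a.
Proof. by case=> h0 _ _; exists 1; rewrite mul1r subrr. Qed.

Lemma adjoin_min I J a : is_ideal J -> (forall f, I f -> J f) -> J a ->
  forall f, adjoin I a f -> J f.
Proof.
move=> hJ IJ Ja f [c /IJ hc]; apply: is_ideal_congr hc _ => //.
by case: hJ => _ _; apply.
Qed.

Lemma adjoin_congr I a b : is_ideal I -> I (a - b) -> adjoin I a = adjoin I b.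
Proof.
move=> hI hab; apply: pred_eq => f; case: (hI) => h0 hD hM; split=> -[c hc]; exists c.
  by have := hD _ _ hc (hM c _ hab); congr (I _); ring.
by have := is_idealB hI hc (hM c _ hab); congr (I _); ring.
Qed.

Definition adjoins I s : R -> Prop := foldl adjoin I s.

Lemma adjoins_ideal I s : is_ideal I -> is_ideal (adjoins I s).
Proof. by elim: s I => //= a s IH I hI; apply/IH/adjoin_ideal. Qed.

Lemma sub_adjoins I s f : I f -> adjoins I s f.
Proof. by elim: s I => //= a s IH I hI; apply/IH/sub_adjoin. Qed.

Lemma mem_adjoins I s f : is_ideal I -> f \in s -> adjoins I s f.
Proof.
elim: s I => //= a s IH I hI; rewrite inE => /orP[/eqP->|].
  exact/sub_adjoins/mem_adjoin.
exact/IH/adjoin_ideal.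
Qed.

Lemma adjoins_min I J s : is_ideal J -> (forall f, I f -> J f) ->
  (forall f, f \in s -> J f) -> forall f, adjoins I s f -> J f.
Proof.
move=> hJ; elim: s I => //= a s IH I hI hs; apply: IH => [|f fs].
  by apply: adjoin_min => //; apply: hs; rewrite mem_head.
by apply: hs; rewrite inE fs orbT.
Qed.

Lemma zero_ideal : is_ideal (fun f : R => f = 0).
Proof.
by split=> // [f g -> ->|a f ->]; [rewrite addr0 | rewrite mulr0].
Qed.

Lemma adjoins0 s : adjoins (fun f => f = 0) s = ideal_gen (fun g => g \in s).
Proof.
apply: pred_eq => f; split.
  apply: adjoins_min => [|g ->|g]; first exact: ideal_gen_ideal.
    by case: (ideal_gen_ideal (fun g => g \in s)).
  exact: sub_ideal_gen.
apply: ideal_gen_min; first exact/adjoins_ideal/zero_ideal.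
by move=> g; apply: mem_adjoins; exact: zero_ideal.
Qed.

(** * Maximal ideals in Noetherian rings *)

Lemma noetherian_fg I : noetherian R -> is_ideal I ->
  exists s, forall f, I f <-> ideal_gen (fun g => g \in s) f.
Proof.
move=> hR hI; have [h1|h1] := pselect (I 1).
  exists [:: 1] => f; split=> _; last by rewrite -[f]mulr1; case: hI => _ _; apply.
  rewrite -[f]mulr1; case: (ideal_gen_ideal (fun g => g \in [:: 1 : R])) => _ _; apply.
  by apply: sub_ideal_gen; rewrite inE.
have [M hM] := is_ideal_idealr hI h1; have [s hs] := hR M; exists s => f.
by rewrite -hM.
Qed.

(** Otherwise the family contains an endless strictly increasing sequence; its union is finitely
    generated, and the generators already lie in one of its members. *)
Lemma noetherian_max (F : (R -> Prop) -> Prop) : noetherian R ->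
  (forall I, F I -> is_ideal I) -> (exists I, F I) ->
  exists2 I, F I &
    forall J, F J -> (forall f, I f -> J f) -> forall f, J f -> I f.
Proof.
move=> hR hF [I0 hI0]; apply: contrapT => hno.
have step (x : {I | F I}) : exists y : {I | F I},
    (forall f, sval x f -> sval y f) /\ ~ (forall f, sval y f -> sval x f).
  case: x => I hI /=; apply: contrapT => hn; apply: hno; exists I => // J hJ IJ.
  apply: contrapT => hJI; apply: hn; exists (exist _ J hJ); split=> //.
have [nxt hnxt] := choice step.
pose c k : R -> Prop := sval (iter k nxt (exist _ I0 hI0)).
have cS k f : c k f -> c k.+1 f by apply: (proj1 (hnxt _)).
have cle k l f : (k <= l)%N -> c k f -> c l f.
  by move=> /subnK<-; elim: (l - k)%N => // m IH /IH; exact: cS.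
have ck k : is_ideal (c k) by apply: hF; apply: svalP.
have hU : is_ideal (fun f => exists k, c k f).
  split; first by exists 0; case: (ck 0).
    move=> f g [k hk] [l hl]; exists (maxn k l).
    case: (ck (maxn k l)) => _ + _; apply; first exact: cle (leq_maxl _ _) hk.
    exact: cle (leq_maxr _ _) hl.
  by move=> a f [k hk]; exists k; case: (ck k) => _ _; apply.
have [s hs] := noetherian_fg hR hU.
have [N hN] : exists N, forall f, f \in s -> c N f.
  have : forall f, f \in s -> exists k, c k f.
    by move=> f fs; apply/hs/sub_ideal_gen.
  elim: (s) => [|a t IH] ht; first by exists 0.
  have [|N hN] := IH; first by move=> f ft; apply: ht; rewrite inE ft orbT.
  have [k hk] := ht a (mem_head _ _); exists (maxn N k) => f.
  rewrite inE => /orP[/eqP->|/hN]; first exact: cle (leq_maxr _ _) hk.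
  exact: cle (leq_maxl _ _).
apply: (proj2 (hnxt (iter N nxt (exist _ I0 hI0)))) => f hf.
by apply: (ideal_gen_min (ck N) hN); apply/hs; exists N.+1.
Qed.

(** An ideal maximal among those that contain I and avoid T is prime: if neither f nor g is in it,
    adjoining them captures elements t and u of T, and fg in the ideal would put tu there. *)
Lemma prime_avoid I T : noetherian R -> is_ideal I -> is_mult_closed T ->
  (forall f, T f -> ~ I f) ->
  exists P, [/\ is_prime P, forall f, I f -> P f & forall f, T f -> ~ P f].
Proof.
move=> hR hI [T1 TM] hIT.
pose F J := [/\ is_ideal J, forall f, I f -> J f & forall f, T f -> ~ J f].
have [||P [hP IP TP] hmax] := @noetherian_max F hR.
- by move=> J [].
- by exists I.
exists P; split=> //; split=> //; first exact: TP.
move=> f g Pfg; apply: contrapT => /not_orP[Pf Pg].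
have meet h : ~ P h -> exists2 t, T t & adjoin P h t.
  move=> Ph; apply: contrapT => hno; apply: Ph; apply: (hmax (adjoin P h)).
  - split; [exact: adjoin_ideal | by move=> u /IP; exact: sub_adjoin |].
    by move=> t Tt ht; apply: hno; exists t.
  - by move=> u; exact: sub_adjoin.
  - exact: mem_adjoin.
have [t Tt [c hc]] := meet f Pf; have [u Tu [d hd]] := meet g Pg.
apply: (TP (t * u)); first exact: TM.
case: (hP) => _ hD hM.
have -> : t * u = t * (u - d * g) + (d * g * (t - c * f) + c * d * (f * g)) by ring.
by apply: (hD); [exact: hM | apply: (hD); exact: hM].
Qed.

(** * Regular sequences *)

(** The nonzerodivisor half of [regular_sequence], relative to I and without properness, so that it
    survives colons and localizations. *)
Definition wreg I s : Prop := forall i, (i < size s)%N ->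
  forall f, adjoins I (take i s) (s`_i * f) -> adjoins I (take i s) f.

Lemma wreg_nil I : wreg I [::]. Proof. by []. Qed.

Lemma wreg_cons I a s :
  wreg I (a :: s) <-> (forall f, I (a * f) -> I f) /\ wreg (adjoin I a) s.
Proof.
split=> [h|[h0 h] [|i] //=]; last exact: h.
by split=> [|i hi]; [exact: (h 0%N) | exact: (h i.+1)].
Qed.

Lemma wreg_full I s : (forall f, I f) -> wreg I s.
Proof. by move=> h i hi f _; apply: sub_adjoins. Qed.

Lemma regular_sequence_wreg s :
  regular_sequence s <->
  wreg (fun f => f = 0) s /\ ~ ideal_gen (fun g => g \in s) 1.
Proof.
by split=> -[h h1]; split=> // i hi f; move: (h i hi f); rewrite adjoins0.
Qed.

(* The Koszul-type exact sequence
   0 -> R/(I : x) -> R/I -> R/(I + x) -> 0 tensored with R/(s). *)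
Lemma wreg_colon I x s : is_ideal I ->
  wreg (fun f => I (x * f)) s -> wreg (adjoin I x) s -> wreg I s.
Proof.
(* [A] stands for I : x. The induction needs (I : x) + (a) to be (I + (a)) : x, which holds because
   [a] is a nonzerodivisor modulo I + (x). *)
have gen A s' : is_ideal I -> (forall f, A f <-> I (x * f)) ->
    wreg A s' -> wreg (adjoin I x) s' -> wreg I s'.
  elim: s' I A => // a {}s IH {}I A hI hA /wreg_cons[ra wa] /wreg_cons[rc wc].
  case: (hI) => h0 hD hM; have hx := adjoin_ideal x hI.
  have redx f : I (a * f) -> exists2 g, A g & I (f - x * g).
    move=> haf; have [|c hc] := rc f; first exact: sub_adjoin.
    exists c; last by rewrite mulrC.
    apply/ra/hA; have := is_idealB hI haf (hM a _ hc); congr (I _); ring.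
  apply/wreg_cons; split=> [f /redx[g /hA hg /(is_ideal_congr hI)]|]; first exact.
  apply: (IH _ (adjoin A a)) => //; first exact: adjoin_ideal.
  - move=> f; split=> [[c /hA hc]|[u hu]].
      by exists (x * c); move: hc; congr (I _); ring.
    have [|v hv] := rc u.
      by exists f; move: (is_idealN hI hu); congr (I _); ring.
    exists v; apply/hA; have := hD _ _ hu (hM a _ hv); congr (I _); ring.
  - suff -> : adjoin (adjoin I a) x = adjoin (adjoin I x) a by [].
    apply: pred_eq => f; split=> -[c [d hd]]; exists d, c.
      by move: hd; congr (I _); ring.
    by move: hd; congr (I _); ring.
by move=> hI; apply: gen.
Qed.

(** * Chains of primes obtained from regular sequences *)

Definition pchain k (P : nat -> R -> Prop) : Prop :=
  (forall i, is_prime (P i)) /\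
  forall i, (i < k)%N ->
    (forall f, P i f -> P i.+1 f) /\ exists2 f, P i.+1 f & ~ P i f.

Lemma prime_chain_pchain k (P : nat -> prime_idealr R) :
  prime_chain k P -> pchain k (fun i f => f \in P i).
Proof.
move=> hP; split=> [i|i /hP[h1 h2]]; first exact: prime_idealr_is_prime.
split=> //; apply: contrapT => hno; apply: h2 => f hf; apply: contrapT => hf'.
by apply: hno; exists f.
Qed.

Lemma pchain_prime_chain k (P : nat -> R -> Prop) : pchain k P ->
  exists2 p : nat -> prime_idealr R, prime_chain k p & forall i f, f \in p i <-> P i f.
Proof.
case=> hP hk; have [p hp] := choice (fun i => is_prime_idealr (hP i)).
exists p => // i /hk[h1 [f h2 h3]]; split; first by move=> g /hp/h1/hp.
by move=> h; apply/h3/hp/h/hp.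
Qed.

Lemma pchain_rcons k (P : nat -> R -> Prop) Q : is_prime Q -> pchain k P ->
  (forall f, P k f -> Q f) -> (exists2 f, Q f & ~ P k f) ->
  pchain k.+1 (fun i => if (i <= k)%N then P i else Q).
Proof.
move=> hQ [hP hk] h1 h2; split=> [i|i]; first by case: ifP.
rewrite ltnS => ik; rewrite ik; move: ik.
rewrite leq_eqVlt => /orP[/eqP->|ik]; first by rewrite ltnn.
by rewrite ik; exact: hk.
Qed.

(* Going down from a prime [Q] containing [s]: the last element of [s] is a
   nonzerodivisor, so its powers times the complement of [Q] avoid the ideal of
   the previous ones. *)
Lemma wreg_pchain_to I s Q : noetherian R -> is_ideal I -> is_prime Q ->
  wreg I s -> (forall f, adjoins I s f -> Q f) ->
  exists2 P, pchain (size s) P & P (size s) = Q.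
Proof.
move=> hR hI; elim/last_ind: s Q => [|s a IH] Q hQ hs sQ.
  by exists (fun=> Q).
pose T f := exists t k, ~ Q t /\ f = t * a ^+ k.
have hs' i : (i <= size s)%N -> take i (rcons s a) = take i s.
  by move=> hi; rewrite -cats1 takel_cat.
have as_ f : adjoins I s (a * f) -> adjoins I s f.
  have := hs (size s); rewrite size_rcons hs' // take_size nth_rcons ltnn eqxx.
  by apply.
have [|||P [hP sP TP]] := @prime_avoid (adjoins I s) T hR.
- exact: adjoins_ideal.
- case: (is_prime_compl hQ) => Q1 QM; split; first by exists 1, 0; rewrite mulr1.
  move=> _ _ [t [k [ht ->]]] [u [l [hu ->]]]; exists (t * u), (k + l)%N.
  by split; [exact: QM | rewrite exprD; ring].
- move=> _ [t [k [ht ->]]]; elim: k => [|k IHk].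
    rewrite mulr1 => h; apply/ht/sQ; rewrite /adjoins foldl_rcons.
    exact: sub_adjoin.
  by rewrite exprS mulrCA => /as_.
have PQ f : P f -> Q f.
  by move=> Pf; apply: contrapT => Qf; apply: (TP f) Pf; exists f, 0; rewrite mulr1.
have [|C hC Ce] := IH P hP _ sP.
  move=> i hi f; have := hs i; rewrite size_rcons hs' 1?ltnW // nth_rcons hi.
  exact.
exists (fun i => if (i <= size s)%N then C i else Q); last first.
  by rewrite size_rcons ltnn.
rewrite size_rcons; apply: pchain_rcons => //; rewrite Ce //.
exists a; first by apply: sQ; apply: mem_adjoins => //; rewrite mem_rcons mem_head.
by apply: (TP a); exists 1, 1; split; [case: hQ | rewrite mul1r].
Qed.

Lemma regular_sequence_chain s : noetherian R -> regular_sequence s ->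
  exists P : nat -> prime_idealr R, prime_chain (size s) P.
Proof.
move=> hR /regular_sequence_wreg[hs h1].
have [|||Q [hQ sQ _]] := @prime_avoid (adjoins (fun f => f = 0) s) (fun f => f = 1) hR.
- exact/adjoins_ideal/zero_ideal.
- by split=> // f g -> ->; rewrite mul1r.
- by move=> _ ->; rewrite adjoins0.
have [|P hP _] := wreg_pchain_to hR _ hQ hs sQ; first exact: zero_ideal.
by have [p hp _] := pchain_prime_chain hP; exists p.
Qed.

(* Going up from an associated prime: [q_i] is the annihilator of [z_i] modulo
   [s_0, ..., s_(i-1)]. A [z] killed by [q_i] that generates a maximal ideal
   modulo [I] cannot be divisible by [a], as in Krull's intersection theorem. *)
Lemma assoc_prime_step I q z a : noetherian R -> is_ideal I ->
  (forall c, exists u, u * (1 - c * a) = 1) ->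
  (forall f, I (a * f) -> I f) ->
  is_prime q -> (forall f, q f <-> I (f * z)) ->
  exists q' z', [/\ is_prime q', forall f, q' f <-> adjoin I a (f * z'),
     forall f, q f -> q' f, q' a & ~ q a].
Proof.
move=> hR hI ha ra hq qz; case: (hI) => I0 ID IM.
have Iz : ~ I z by move=> h; case: hq => _ q1 _; apply/q1/qz; rewrite mul1r.
pose F J := exists y, [/\ J = adjoin I y, ~ I y & forall f, q f -> I (f * y)].
have [||J [y [-> Iy qy]] ymax] := @noetherian_max F hR.
- by move=> _ [y [-> _ _]]; exact: adjoin_ideal.
- by exists (adjoin I z), z; split=> // f /qz.
(* If y = wa modulo I, then q kills w too, since [a] is a nonzerodivisor. As wa is y modulo I, I +
   (w) contains I + (y), so maximality gives w = cy = cwa modulo I. But 1 - ca is a unit, which puts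
   w and then y in I. *)
have ay : ~ adjoin I a y.
  move=> [w hw].
  have aw f : I (f * y) -> I (f * w).
    move=> h; apply: ra; have := is_idealB hI h (IM f _ hw); congr (I _); ring.
  have Iw : ~ I w.
    move=> h; apply: Iy; apply: is_ideal_congr hw _ => //.
    exact: is_idealMr.
  have [] := ymax (adjoin I w) _ _ w; first by exists w; split=> // f /qy/aw.
  - apply: adjoin_min; [exact: adjoin_ideal | exact: sub_adjoin |].
    by exists a; rewrite mulrC.
  - exact: mem_adjoin.
  move=> c hc; apply: Iw; have [u hu] := ha c.
  rewrite -[w]mul1r -hu -mulrA; apply: (IM).
  by have := ID _ _ hc (IM c _ hw); congr (I _); ring.
have hIa := adjoin_ideal a hI.
(* A maximal annihilator among the multiples of y that are nonzero modulo I + (a) is prime. It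
   contains q because q kills y. *)
pose G J := exists c, J = (fun f => adjoin I a (f * (c * y))) /\
  ~ adjoin I a (c * y).
have [||J2 [c [-> hc]] cmax] := @noetherian_max G hR.
- move=> _ [c [-> _]]; case: (hIa) => h0 hD hM; split=> [|f g|b f] /=.
  + by rewrite mul0r.
  + by rewrite mulrDl; exact: hD.
  + by rewrite -mulrA; exact: hM.
- by exists (fun f => adjoin I a (f * (1 * y))), 1; rewrite mul1r.
case: (hIa) => h0 hD hM.
exists (fun f => adjoin I a (f * (c * y))), (c * y); split=> //.
- split.
  + split=> [|f g|b f] /=; rewrite ?mul0r ?mulrDl -?mulrA //; first exact: hD.
    exact: hM.
  + by rewrite mul1r.
  + move=> f g hfg; have [hf|hf] := pselect (adjoin I a (f * (c * y))); first by left.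
    right; apply: (cmax (fun h => adjoin I a (h * ((f * c) * y)))).
    * by exists (f * c); split=> //; rewrite -mulrA.
    * by move=> h hh; move: (hM f _ hh); congr adjoin; ring.
    * by move: hfg; congr adjoin; ring.
- move=> f /qy hf; apply: sub_adjoin; have := IM c _ hf; congr (I _); ring.
- by rewrite mulrC; apply: (hM); exact: mem_adjoin.
- by move=> /qz/ra.
Qed.

(** Each regular element replaces an associated prime by a strictly larger one, associated to the
    next quotient. *)
Lemma assoc_prime_chain I q z s : noetherian R -> is_ideal I ->
  (forall a c, a \in s -> exists u, u * (1 - c * a) = 1) -> wreg I s ->
  is_prime q -> (forall f, q f <-> I (f * z)) ->
  exists2 P, pchain (size s) P & P 0%N = q.
Proof.
move=> hR; elim: s I q z => [|a s IH] I q z hI ha; first by exists (fun=> q).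
move=> /wreg_cons[ra ws] hq qz.
have [|q' [z' [hq' qz' qq' q'a qa]]] := assoc_prime_step hR hI _ ra hq qz.
  by move=> c; apply: ha; rewrite mem_head.
have [|P [hP hk] P0] := IH _ q' z' (adjoin_ideal a hI) _ ws hq' qz'.
  by move=> b c bs; apply: ha; rewrite inE bs orbT.
exists (fun i => if i is j.+1 then P j else q) => //.
split=> [[]//|[_|i]]; last exact: hk.
by rewrite P0; split=> //; exists a.
Qed.

End Ideals.

(** * Quotients and localizations *)

(* [l] identifies [R'] with the localization of [R/J] at [T]; quotients are the
   case [T = {1}]. *)
Record locquo (R R' : comNzRingType) (T J : R -> Prop)
    (l : {rmorphism R -> R'}) : Prop := Locquo {
  locquo_mult : is_mult_closed T;
  locquo_ideal : is_ideal J;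
  locquo_surj : forall y, exists x s, T s /\ y * l s = l x;
  locquo_unit : forall s, T s -> exists u, l s * u = 1;
  locquo_ker : forall x, l x = 0 <-> exists2 t, T t & J (t * x) }.

Section Locquo.
Variables (R R' : comNzRingType) (T J : R -> Prop) (l : {rmorphism R -> R'}).
Hypothesis hl : locquo T J l.

Lemma comap_ideal (I : R' -> Prop) : is_ideal I -> is_ideal (fun x => I (l x)).
Proof.
case=> h0 hD hM; split; first by rewrite rmorph0.
  by move=> f g; rewrite rmorphD; exact: hD.
by move=> a f; rewrite rmorphM; exact: hM.
Qed.

Lemma comap_prime (P : R' -> Prop) : is_prime P -> is_prime (fun x => P (l x)).
Proof.
case=> hI h1 hP; split; first exact: comap_ideal.
  by rewrite rmorph1.
by move=> f g; rewrite rmorphM; exact: hP.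
Qed.

Lemma locquo_cancel (I : R' -> Prop) y s : is_ideal I -> T s ->
  I (y * l s) -> I y.
Proof.
move=> hI /(locquo_unit hl)[u hu] h.
by rewrite -[y]mulr1 -hu mulrA; exact: is_idealMr.
Qed.

Lemma comap_sub (I : R' -> Prop) x : is_ideal I -> J x -> I (l x).
Proof.
move=> [I0 _ _] Jx; have -> // : l x = 0; apply/(locquo_ker hl).
by exists 1; [case: (locquo_mult hl) | rewrite mul1r].
Qed.

Lemma locquo_noetherian : noetherian R -> noetherian R'.
Proof.
move=> hR M; have hM := idealr_is_ideal M.
have [s hs] := noetherian_fg hR (comap_ideal hM).
exists (map l s) => y; split; last first.
  apply: (ideal_gen_min hM) => _ /mapP[x xs ->].
  by apply/hs; exact: sub_ideal_gen.
move=> yM; have [x [t [Tt e]]] := locquo_surj hl y.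
have hG := ideal_gen_ideal (fun g => g \in map l s).
apply: (locquo_cancel hG Tt); rewrite e.
have xs : ideal_gen (fun g => g \in s) x by apply/hs; rewrite -e; exact: (is_idealMr _ hM).
have := ideal_gen_min (comap_ideal hG) _ xs; apply=> g gs.
by apply: sub_ideal_gen; exact: map_f.
Qed.

Definition ext_ideal (I : R -> Prop) : R' -> Prop :=
  fun y => exists x s, [/\ T s, I x & y * l s = l x].

Lemma ext_ideal_ideal I : is_ideal I -> is_ideal (ext_ideal I).
Proof.
case=> I0 ID IM; have [T1 TM] := locquo_mult hl; split.
- by exists 0, 1; split; rewrite // mul0r rmorph0.
- move=> y z [x [s [Ts Ix e]]] [x' [s' [Ts' Ix' e']]].
  exists (s' * x + s * x'), (s * s'); split; [exact: TM | |].
    by apply: ID; exact: IM.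
  by rewrite rmorphD !rmorphM -e -e'; ring.
- move=> a y [x [s [Ts Ix e]]].
  have [b [t [Tt ea]]] := locquo_surj hl a.
  exists (b * x), (t * s); split; [exact: TM | exact: IM |].
  by rewrite !rmorphM -e -ea; ring.
Qed.

Lemma ext_idealE I x : is_ideal I -> (forall f, J f -> I f) ->
  ext_ideal I (l x) <-> exists2 t, T t & I (t * x).
Proof.
move=> hI JI; case: (hI) => I0 ID IM; have [T1 TM] := locquo_mult hl; split.
  move=> [x' [s [Ts Ix' e]]].
  have /(locquo_ker hl)[t Tt /JI ht] : l (x * s - x') = 0.
    by rewrite rmorphB rmorphM e subrr.
  exists (t * s); first exact: TM.
  by have := ID _ _ ht (IM t _ Ix'); congr (I _); ring.
move=> [t Tt ht]; exists (t * x), t; split=> //.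
by rewrite rmorphM mulrC.
Qed.

Lemma ext_ideal_ker y : ext_ideal J y <-> y = 0.
Proof.
have [T1 TM] := locquo_mult hl; split=> [[x [s [Ts Jx e]]]|->]; last first.
  by exists 0, 1; split; rewrite ?mul0r ?rmorph0 //; case: (locquo_ideal hl).
have /= := locquo_cancel (zero_ideal R') Ts; apply; rewrite e.
exact: (comap_sub (zero_ideal R') Jx).
Qed.

Lemma ext_primeE P x : is_prime P -> (forall f, J f -> P f) ->
  (forall f, T f -> ~ P f) -> ext_ideal P (l x) <-> P x.
Proof.
move=> hP JP TP; rewrite ext_idealE //; last exact: is_prime_ideal.
have [T1 TM] := locquo_mult hl; split=> [[t Tt]|Px].
  by case: hP => _ _ h /h[/(TP _ Tt)|].
by exists 1; rewrite ?mul1r.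
Qed.

Lemma ext_prime P : is_prime P -> (forall f, J f -> P f) ->
  (forall f, T f -> ~ P f) -> is_prime (ext_ideal P).
Proof.
move=> hP JP TP; have hE := ext_ideal_ideal (is_prime_ideal hP); split=> //.
  by rewrite -(rmorph1 l) ext_primeE //; case: hP.
move=> y z; have [x [s [Ts e]]] := locquo_surj hl y.
have [x' [s' [Ts' e']]] := locquo_surj hl z.
move=> /(is_idealMr (l s * l s') hE); rewrite mulrACA e e' -rmorphM ext_primeE //.
case: hP (hP) => _ _ hM hP /hM[] h; [left|right].
  by apply: (locquo_cancel hE Ts); rewrite e ext_primeE.
by apply: (locquo_cancel hE Ts'); rewrite e' ext_primeE.
Qed.

Lemma comap_pchain k (P : nat -> R' -> Prop) : pchain k P ->
  pchain k (fun i x => P i (l x)).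
Proof.
case=> hP hk; split=> [i|i ik]; first exact: comap_prime.
have [h1 [y h2 h3]] := hk i ik; split=> [f|]; first exact: h1.
have [x [s [Ts e]]] := locquo_surj hl y; exists x; rewrite -e.
  by apply: is_idealMr => //; exact: is_prime_ideal.
by apply: contra_not h3; apply: locquo_cancel => //; exact: is_prime_ideal.
Qed.

Lemma ext_pchain k (P : nat -> R -> Prop) : pchain k P ->
  (forall i f, J f -> P i f) -> (forall i f, T f -> ~ P i f) ->
  pchain k (fun i => ext_ideal (P i)).
Proof.
case=> hP hk JP TP; split=> [i|i ik]; first by apply: ext_prime => // f; [exact: JP | exact: TP].
have [h1 [x h2 h3]] := hk i ik; split.
  by move=> y [z [s [Ts Pz e]]]; exists z, s; split=> //; exact: h1.
by exists (l x); rewrite ext_primeE // => f; first [exact: JP | exact: TP].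
Qed.

Lemma ext_adjoin I a : is_ideal I -> (forall f, J f -> I f) ->
  ext_ideal (adjoin I a) = adjoin (ext_ideal I) (l a).
Proof.
move=> hI JI; have [T1 TM] := locquo_mult hl; apply: pred_eq => y; split.
  move=> [x [s [Ts [c hc] e]]].
  have [u hu] := locquo_unit hl Ts; exists (l c * u), (x - c * a), s.
  split=> //; rewrite mulrBl e rmorphB rmorphM; congr (_ - _).
  by have -> : l c * u * l a * l s = l c * l a * (l s * u) by [ring]; rewrite hu mulr1.
move=> [c hc]; have hE := adjoin_ideal a hI.
have := ext_ideal_ideal hE.
case=> _ hD hM; rewrite -[y](subrK (c * l a)); apply: hD.
  by case: hc => x [s [Ts Ix e]]; exists x, s; split=> //; exact: sub_adjoin.
apply: hM; rewrite ext_idealE //; last by move=> f /JI; exact: sub_adjoin.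
by exists 1; rewrite ?mul1r //; exact: mem_adjoin.
Qed.

Lemma ext_wreg I s : is_ideal I -> (forall f, J f -> I f) -> wreg I s ->
  wreg (ext_ideal I) (map l s).
Proof.
elim: s I => // a s IH I hI JI /wreg_cons[ra ws]; apply/wreg_cons; split.
  move=> y; have [x [t [Tt e]]] := locquo_surj hl y.
  have hE := ext_ideal_ideal hI.
  move=> /(is_idealMr (l t) hE); rewrite -mulrA e -rmorphM.
  rewrite ext_idealE // => -[u Tu]; rewrite mulrCA => /ra h.
  by apply: (locquo_cancel hE Tt); rewrite e ext_idealE //; exists u.
rewrite -ext_adjoin //; apply: IH => //; first exact: adjoin_ideal.
by move=> f /JI; exact: sub_adjoin.
Qed.

Lemma locquo_wreg s : wreg J s -> wreg (fun y => y = 0) (map l s).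
Proof.
move=> /(ext_wreg (locquo_ideal hl))-/(_ (fun f h => h)).
by congr (wreg _ _); apply: pred_eq => y; exact: ext_ideal_ker.
Qed.

End Locquo.

Lemma ideal_quot_locquo (R : comNzRingType) (M : idealr R) :
  locquo (fun f => f = 1) (fun f => f \in M)
    (\pi_{ideal_quot M}%qT : {rmorphism R -> {ideal_quot M}}).
Proof.
split.
- by split=> // f g -> ->; rewrite mulr1.
- exact: idealr_is_ideal.
- by elim/quotW=> x; exists x, 1; rewrite rmorph1 mulr1.
- by move=> _ ->; exists 1; rewrite rmorph1 mulr1.
- move=> x; split=> [|[_ -> ]].
    move/eqP; rewrite -(rmorph0 (\pi_{ideal_quot M}%qT : {rmorphism _ -> _})).
    by rewrite -Quotient.idealrBE subr0 => h; exists 1; rewrite ?mul1r.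
  rewrite mul1r -[x]subr0 Quotient.idealrBE subr0 => /eqP e.
  exact: etrans e (rmorph0 _).
Qed.

Section Localization.
Variables (R : comNzRingType) (p : prime_idealr R).

Definition to_loc (a : R) : localization p :=
  (\pi_(Localization.type p) (Localization.of_ring p a))%qT.

Lemma to_loc_additive : {morph to_loc : x y / x - y}.
Proof.
move=> x y.
have -> : to_loc x - to_loc y =
    Localization.add (to_loc x) (Localization.opp (to_loc y)) by [].
rewrite /to_loc Localization.opp_pi Localization.add_pi.
by apply: Localization.pi_inj => /=; ring.
Qed.

Lemma to_loc_multiplicative : monoid_morphism to_loc.
Proof.
split=> // x y.
suff -> : to_loc x * to_loc y = Localization.mul (to_loc x) (to_loc y).
  by rewrite /to_loc Localization.mul_pi; apply: Localization.pi_inj => /=; ring.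
by [].
Qed.

HB.instance Definition _ :=
  GRing.isZmodMorphism.Build R (localization p) to_loc to_loc_additive.
HB.instance Definition _ :=
  GRing.isMonoidMorphism.Build R (localization p) to_loc to_loc_multiplicative.

Lemma localization_locquo : locquo (fun f => f \notin p) (fun f => f = 0) to_loc.
Proof.
have mulE x y : x * y = Localization.mul x y :> localization p by [].
split.
- by split=> [|f g]; [exact: Localization.den1 | exact: Localization.denM].
- exact: zero_ideal.
- elim/quotW=> x; exists (Localization.pair_of x).1, (Localization.pair_of x).2.
  split; first exact: Localization.denP.
  by rewrite mulE /to_loc Localization.mul_pi; apply: Localization.pi_inj => /=; ring.
- move=> s ps; exists (\pi_(Localization.type p) (@Localization.Fracs _ p (1, s) ps))%qT.
  rewrite mulE /to_loc Localization.mul_pi.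
  by apply: (@Localization.pi_inj _ _ _ (Localization.of_ring p 1)) => /=; ring.
- move=> x; split=> [/eqP/Localization.piP[t pt] /=|[t pt e]].
    by rewrite mulr1 mul0r mulr0 => e; exists t.
  apply/eqP/Localization.piP; exists t => //=.
  by rewrite mulr1 e mul0r mulr0.
Qed.

End Localization.

Lemma locquo_comp (R R1 R2 : comNzRingType) (J : R -> Prop) (T : R1 -> Prop)
    (l1 : {rmorphism R -> R1}) (l2 : {rmorphism R1 -> R2}) :
  locquo (fun f => f = 1) J l1 -> locquo T (fun f => f = 0) l2 ->
  locquo (fun f => T (l1 f)) J (l2 \o l1).
Proof.
move=> h1 h2; have [T1 TM] := locquo_mult h2.
have surj1 y : exists x, y = l1 x.
  by have [x [s [-> e]]] := locquo_surj h1 y; exists x; rewrite -e rmorph1 mulr1.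
split.
- split; first by rewrite rmorph1.
  by move=> f g hf hg; rewrite rmorphM; exact: TM.
- exact: locquo_ideal h1.
- move=> y; have [x [s [Ts e]]] := locquo_surj h2 y.
  have [a ea] := surj1 x; have [b eb] := surj1 s; exists a, b.
  by rewrite -eb /= -ea -eb.
- by move=> s Ts; exact: (locquo_unit h2).
- move=> x /=; rewrite (locquo_ker h2); split=> [[y Ty]|[t Tt Jt]].
    have [t et] := surj1 y; rewrite et -rmorphM => /(locquo_ker h1)[_ -> ].
    by rewrite mul1r; exists t; rewrite -?et.
  exists (l1 t) => //; rewrite -rmorphM; apply/(locquo_ker h1).
  by exists 1; rewrite ?mul1r.
Qed.

(** * Depth and dimension of a quotient localized at a prime *)

Section LocalRing.
Variables (R R' : comNzRingType) (q J : R -> Prop) (l : {rmorphism R -> R'}).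
Hypothesis hl : locquo (fun f => ~ q f) J l.
Hypotheses (hq : is_prime q) (Jq : forall f, J f -> q f).

Let ext_q x : ext_ideal (fun f => ~ q f) l q (l x) <-> q x.
Proof. exact: (ext_primeE hl x hq Jq (fun f hf => hf)). Qed.

Let prime_ext_q : is_prime (ext_ideal (fun f => ~ q f) l q).
Proof. exact: (ext_prime hl hq Jq (fun f hf => hf)). Qed.

Lemma proper_sub_ext (I : R' -> Prop) y : is_ideal I -> ~ I 1 -> I y ->
  ext_ideal (fun f => ~ q f) l q y.
Proof.
move=> hI I1 Iy; have [x [s [qs e]]] := locquo_surj hl y.
exists x, s; split=> //; apply: contrapT => qx; apply: I1.
by apply: (locquo_cancel hl hI qx); rewrite mul1r -e; exact: is_idealMr.
Qed.

Lemma local_maximal : exists2 M : idealr R', maximal_ideal M &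
  forall y, y \in M <-> ext_ideal (fun f => ~ q f) l q y.
Proof.
case: (prime_ext_q) => hI h1 _; have [M hM] := is_ideal_idealr hI h1.
exists M => // N _ y yN; apply/hM/(proper_sub_ext (idealr_is_ideal N)) => //.
by rewrite idealr1.
Qed.

Lemma maximal_local (M : idealr R') : maximal_ideal M ->
  forall y, y \in M <-> ext_ideal (fun f => ~ q f) l q y.
Proof.
move=> hM y; have sub z : z \in M -> ext_ideal (fun f => ~ q f) l q z.
  by apply: (proper_sub_ext (idealr_is_ideal M)); rewrite idealr1.
have [N _ hN] := local_maximal; split=> [/sub//|hy].
by apply: (hM N); [move=> z /sub/hN | apply/hN].
Qed.

Lemma local_unit y : ~ ext_ideal (fun f => ~ q f) l q y -> exists u, u * y = 1.
Proof.
move=> hy; have [x [s [qs e]]] := locquo_surj hl y.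
have qx : ~ q x by move=> qx; apply: hy; exists x, s.
have [u hu] := locquo_unit hl qx; exists (l s * u).
by rewrite mulrC mulrA e.
Qed.

(** The image of [s] is regular and gives a chain of its own length, while every regular sequence
    gives a chain and is bounded with it. Thus [size s] is both the depth and the dimension. *)
Lemma locquo_cohen_macaulay s : noetherian R ->
  wreg J s -> (forall a, a \in s -> q a) ->
  (forall k P, pchain k P -> (forall f, J f -> P 0%N f) -> (k <= size s)%N) ->
  cohen_macaulay_local R'.
Proof.
move=> hR ws sq hb M hM; have EM := maximal_local hM.
have hR' := locquo_noetherian hl hR.
have le k (P : nat -> prime_idealr R') : prime_chain k P -> (k <= size s)%N.
  move=> /prime_chain_pchain hP; apply: hb (comap_pchain hl hP) _ => f Jf.
  exact: (comap_sub hl (idealr_is_ideal (P 0%N)) Jf).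
have ls : {subset map l s <= M}.
  by move=> _ /mapP[a /sq qa ->]; apply/EM/ext_q.
have rs : regular_sequence (map l s).
  apply/regular_sequence_wreg; split; first exact: (locquo_wreg hl).
  move=> h; have := ideal_gen_min (idealr_is_ideal M) ls h.
  by rewrite idealr1.
exists (size s); split; split.
- by exists (map l s); split; rewrite ?size_map.
- by move=> t ht _; have [P hP] := regular_sequence_chain hR' ht; exact: le hP.
- by have [P hP] := regular_sequence_chain hR' rs; exists P; rewrite size_map in hP.
- exact: le.
Qed.

(** The number k is the common value of depth and dimension, carried back to R: as dimension it
    bounds the chains between J and q, as depth it starts a chain at every associated prime inside
    q. *)
Lemma cohen_macaulay_localP : noetherian R -> cohen_macaulay_local R' ->
  exists k,
  (forall m P, pchain m P -> (forall i f, J f -> P i f) ->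
    (forall i f, P i f -> q f) -> (m <= k)%N) /\
  forall P z, is_prime P -> (forall f, P f -> q f) ->
    (forall f, P f <-> J (f * z)) -> exists2 C, pchain k C & C 0%N = P.
Proof.
move=> hR cm; have [M hM EM] := local_maximal.
have [k [[[s [rs sM ss]] _] [_ hk]]] := cm M hM; exists k; split.
  move=> m P hP JP Pq.
  have /pchain_prime_chain[p hp _] : pchain m (fun i => ext_ideal (fun f => ~ q f) l (P i)).
    by apply: (ext_pchain hl) => // i f qf /Pq.
  exact: hk hp.
move=> P z hP Pq Pz; have hR' := locquo_noetherian hl hR.
have hPz f : J f -> P f by move=> Jf; apply/Pz; exact: (is_idealMr z (locquo_ideal hl) Jf).
have PT f : ~ q f -> ~ P f by move=> h /Pq.
have hP' := ext_prime hl hP hPz PT.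
have /regular_sequence_wreg[ws _] := rs.
have [||C hC C0] := assoc_prime_chain hR' (zero_ideal R') _ ws hP' (z := l z).
- move=> a c /sM/EM qa; apply: local_unit => h; case: (prime_ext_q) => hI h1 _; apply: h1.
  have -> : 1 = (1 - c * a) + c * a by ring.
  by case: (hI) => _ hD hc; apply: hD => //; exact: hc.
- move=> y; have [x [t [qt e]]] := locquo_surj hl y.
  have -> : ext_ideal (fun f => ~ q f) l P y <-> P x.
    have hE := is_prime_ideal hP'.
    rewrite -(ext_primeE hl x hP hPz PT) -e; split=> h.
      exact: (is_idealMr _ hE h).
    exact: (locquo_cancel hl hE qt h).
  have -> : y * l z = 0 <-> l (x * z) = 0.
    rewrite rmorphM -e mulrAC; split=> [->|]; first by rewrite mul0r.
    exact: (locquo_cancel hl (zero_ideal R') qt).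
  rewrite (locquo_ker hl); split=> [Px|[u qu]].
    by exists 1; [case: hq | rewrite mul1r; apply/Pz].
  by rewrite mulrA => /Pz; case: hP => _ _ h /h[/PT|].
exists (fun i x => C i (l x)); first by rewrite -ss; exact: (comap_pchain hl).
by rewrite C0; apply: pred_eq => x; exact: (ext_primeE hl).
Qed.

End LocalRing.

(** * Hilbert's basis theorem *)

Lemma noetherian_surj (R R' : comNzRingType) (l : {rmorphism R -> R'}) :
  (forall y, exists x, l x = y) -> noetherian R -> noetherian R'.
Proof.
move=> hl; apply: (@locquo_noetherian _ _ (fun f => f = 1) (fun x => l x = 0) l).
split=> [|||_ ->|x].
- by split=> // _ _ -> ->; rewrite mulr1.
- split; first by rewrite rmorph0.
    by move=> f g; rewrite rmorphD => -> ->; rewrite addr0.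
  by move=> a f; rewrite rmorphM => ->; rewrite mulr0.
- by move=> y; have [x <-] := hl y; exists x, 1; rewrite rmorph1 mulr1.
- by exists 1; rewrite rmorph1 mulr1.
- by split=> [lx|[_ ->]]; [exists 1 | ]; rewrite ?mul1r.
Qed.

Lemma noetherian_field (R : comNzRingType) :
  (forall x : R, x != 0 -> exists y, y * x = 1) -> noetherian R.
Proof.
move=> hR M; exists [::] => f; split=> [fM|[s hs ->]]; last first.
  by case: s hs => [_|x s /(_ x (mem_head _ _))//]; rewrite big_nil idealr0.
exists [::] => //; rewrite big_nil; apply/eqP; apply: contraT => /hR[y e].
by rewrite -(idealr1 M) -e idealMr.
Qed.

Section HilbertBasis.
Variable R : comNzRingType.
Implicit Types (I : {poly R} -> Prop) (s : seq {poly R}).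

Let gen s := ideal_gen (fun g : {poly R} => g \in s).

(* [f_k] has minimal size among the elements of [I] outside [(f_0, ..., f_(k-1))];
   its leading coefficient is eventually a combination of the previous ones. *)
Lemma noetherian_poly : noetherian R -> noetherian {poly R}.
Proof.
move=> hR M; pose I f := f \in M.
have hM : is_ideal I := idealr_is_ideal M.
apply: contrapT => hno.
have next s : {subset s <= M} -> exists f,
    [/\ I f, ~ gen s f & forall g, I g -> ~ gen s g -> (size f <= size g)%N].
  move=> sM; have : exists k, `[< exists f, [/\ I f, ~ gen s f & size f = k] >].
    apply: contrapT => h; apply: hno; exists s => f; split; last first.
      exact: (ideal_gen_min hM).
    move=> If; apply: contrapT => gf; apply: h; exists (size f); apply/asboolP.
    by exists f.
  move=> /ex_minnP[_ /asboolP[f [If gf <-]] hmin]; exists f; split=> // g Ig gg.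
  by apply: hmin; apply/asboolP; exists g.
have [F hF] : exists F, forall s, {subset s <= M} ->
    [/\ I (F s), ~ gen s (F s) &
     forall g, I g -> ~ gen s g -> (size (F s) <= size g)%N].
  have /choice[F hF] : forall s, exists f, {subset s <= M} ->
      [/\ I f, ~ gen s f & forall g, I g -> ~ gen s g -> (size f <= size g)%N].
    move=> s; have [/next[f hf]|h] := pselect {subset s <= M}; first by exists f.
    by exists 0 => /h.
  by exists F.
pose S k := iter k (fun s => rcons s (F s)) [::].
have SM k : {subset S k <= M}.
  elim: k => //= k IH f; rewrite mem_rcons inE => /orP[/eqP->|/IH//].
  by have [] := hF _ IH.
have Sle k m : (k <= m)%N -> {subset S k <= S m}.
  move=> /subnK<-; elim: (m - k)%N => // j IH f /IH h.
  by rewrite /= mem_rcons inE h orbT.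
have genS k m f : (k <= m)%N -> gen (S k) f -> gen (S m) f.
  move=> km; apply: ideal_gen_min; first exact: ideal_gen_ideal.
  by move=> g /(Sle _ _ km) gs; exact: sub_ideal_gen.
have szF k m : (k <= m)%N -> (size (F (S k)) <= size (F (S m)))%N.
  move=> km; have [_ _ h] := hF _ (SM k); have [If gf _] := hF _ (SM m).
  by apply: h => // /(genS _ _ _ km).
(* The ideals of leading coefficients increase with k; their union is finitely generated, hence
   reached at some N. *)
pose L k a := ideal_gen (fun c => c \in map lead_coef (S k)) a.
have LS k m a : (k <= m)%N -> L k a -> L m a.
  move=> km; apply: ideal_gen_min; first exact: ideal_gen_ideal.
  move=> _ /mapP[f /(Sle _ _ km) fs ->]; apply: sub_ideal_gen.
  exact: map_f.
have hL : is_ideal (fun a => exists k, L k a).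
  split; first by exists 0; case: (ideal_gen_ideal (fun c => c \in map lead_coef (S 0))).
    move=> a b [k ha] [m hb]; exists (maxn k m).
    case: (ideal_gen_ideal (fun c => c \in map lead_coef (S (maxn k m)))) => _ + _; apply.
      exact: (LS _ _ _ (leq_maxl _ _)).
    exact: (LS _ _ _ (leq_maxr _ _)).
  move=> a b [k hb]; exists k.
  by case: (ideal_gen_ideal (fun c => c \in map lead_coef (S k))) => _ _; apply.
have [t ht] := noetherian_fg hR hL.
have [N hN] : exists N, forall a, a \in t -> L N a.
  have : forall a, a \in t -> exists k, L k a.
    by move=> a ta; apply/ht/sub_ideal_gen.
  elim: (t) => [|a u IH] hu; first by exists 0.
  have [|N hN] := IH; first by move=> b bu; apply: hu; rewrite inE bu orbT.
  have [k hk] := hu a (mem_head _ _); exists (maxn N k) => b.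
  rewrite inE => /orP[/eqP->|/hN]; first exact: (LS _ _ _ (leq_maxr _ _)).
  exact: (LS _ _ _ (leq_maxl _ _)).
have [If gf hmin] := hF _ (SM N); set f := F (S N) in If gf hmin.
have f0 : f != 0.
  apply/eqP => e; apply: gf; rewrite e.
  by case: (ideal_gen_ideal (fun g => g \in S N)).
have Lf : L N (lead_coef f).
  have := ideal_gen_min (ideal_gen_ideal _) hN; apply; apply/ht; exists N.+1.
  apply: sub_ideal_gen; apply: map_f.
  by rewrite /= mem_rcons mem_head.
pose D := size f.
case: (ideal_gen_ideal (fun g => g \in S N)) => g0 gD gM.
(* The earlier polynomials are no longer than f, so powers of X raise each of them to size D. A
   combination of these then has the leading coefficient of f at degree D - 1, and f - g is too
   short to lie outside the ideal of [S N]. *)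
have [g [gg sg eg]] : exists g, [/\ gen (S N) g, (size g <= D)%N & g`_D.-1 = lead_coef f].
  pose A a := exists g, [/\ gen (S N) g, (size g <= D)%N & g`_D.-1 = a].
  suff : forall a, L N a -> A a by apply.
  apply: ideal_gen_min => [|_ /mapP[h hs ->]].
    split; first by exists 0; rewrite size_poly0 coef0.
      move=> a b [g [gg sg <-]] [h [gh sh <-]]; exists (g + h); split.
      - exact: gD.
      - by rewrite (leq_trans (size_polyD _ _)) // geq_max sg.
      - by rewrite coefD.
    move=> a b [g [gg sg <-]]; exists (a%:P * g); split; first exact: gM.
      by rewrite mul_polyC (leq_trans (size_scale_leq _ _)).
    by rewrite coefCM.
  have [k kN ->] : exists2 k, (k < N)%N & h = F (S k).
    elim: (N) hs => //= k IH; rewrite mem_rcons inE => /orP[/eqP->|/IH[m mk ->]].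
      by exists k.
    by exists m => //; exact: leqW.
  have [_ gk _] := hF _ (SM k).
  have h0 : F (S k) != 0.
    apply/eqP => e; apply: gk; rewrite e.
    by case: (ideal_gen_ideal (fun g => g \in S k)).
  have hD : (size (F (S k)) <= D)%N by apply: szF; exact: ltnW.
  exists ('X^(D - size (F (S k))) * F (S k)); split.
  - apply: gM; apply: sub_ideal_gen; apply: (Sle k.+1) => //.
    by rewrite /= mem_rcons mem_head.
  - by rewrite mulrC size_mulXn // subnK.
  - have s0 : (0 < size (F (S k)))%N by rewrite size_poly_gt0.
    rewrite coefXnM ifN; last by rewrite -leqNgt; lia.
    by rewrite lead_coefE; congr (_`__); lia.
have sfg : (size (f - g)%R < D)%N.
  rewrite -[D]prednK ?size_poly_gt0 // ltnS; apply/leq_sizeP => j.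
  rewrite leq_eqVlt => /orP[/eqP<-|hj]; first by rewrite coefB eg subrr.
  have Dj : (D <= j)%N by rewrite -[D]prednK ?size_poly_gt0.
  by rewrite coefB !nth_default ?subrr // (leq_trans sg).
have : ~ (D <= size (f - g)%R)%N by rewrite leqNgt sfg.
apply; apply: hmin.
  by have := is_idealB hM If; apply; exact: (ideal_gen_min hM (SM N)).
by move=> h; apply: gf; rewrite -(subrK g f); exact: gD.
Qed.

End HilbertBasis.

(** * Polynomial rings *)

Section MPolyRing.
Variables (n : nat) (R : comNzRingType).

Lemma mpoly_ring_ind (P : {mpoly R[n]} -> Prop) :
  (forall c, P c%:MP) -> (forall i, P 'X_i) ->
  (forall f g, P f -> P g -> P (f + g)) ->
  (forall f g, P f -> P g -> P (f * g)) -> forall f, P f.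
Proof.
move=> PC PX PD PM f; rewrite [f]mpolyE.
apply: (big_ind P) => [|f1 f2|u _]; [by rewrite -(mpolyC0 n R) | exact: PD |].
rewrite -mul_mpolyC mpolyXE_id; apply: (PM) => //.
apply: (big_ind P) => [|f1 f2|i _]; [by rewrite -mpolyC1 | exact: PM |].
elim: (u i) => [|k IH]; first by rewrite expr0 -mpolyC1.
by rewrite exprS; exact: PM.
Qed.

Lemma mpoly_rmorph_eq (T : nzRingType) (f g : {rmorphism {mpoly R[n]} -> T}) :
  (forall c, f c%:MP = g c%:MP) -> (forall i, f 'X_i = g 'X_i) -> f =1 g.
Proof.
move=> hC hX; apply: mpoly_ring_ind => // p q ep eq.
  by rewrite !rmorphD ep eq.
by rewrite !rmorphM ep eq.
Qed.

End MPolyRing.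

Lemma noetherian_mpoly (K : fieldType) n : noetherian {mpoly K[n]}.
Proof.
elim: n => [|n IH].
  apply: noetherian_field => x; rewrite [x]nvar0_mpolyC mpolyC_eq0 => h.
  by exists (x@_0)^-1%:MP; rewrite -mpolyCM mulVf.
have cX : commr_rmorph (@mwiden n K) ('X_ord_max : {mpoly K[n.+1]}) by move=> f; exact: mulrC.
apply: (@noetherian_surj _ _ (horner_morph cX)) (noetherian_poly IH).
apply: mpoly_ring_ind => [c|i|f g [p <-] [q <-]|f g [p <-] [q <-]].
- by exists c%:MP%:P; rewrite /= horner_morphC /= mwidenC.
- case: (unliftP ord_max i) => [j|] ->; last by exists 'X; rewrite /= horner_morphX.
  exists ('X_j)%:P; rewrite /= horner_morphC /= mwidenX mnmwiden1; congr 'X_[U_(_)].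
  by apply: val_inj; rewrite /= /bump leqNgt ltn_ord.
- by exists (p + q); rewrite rmorphD.
- by exists (p * q); rewrite rmorphM.
Qed.

Section Restriction.
Variables (K : fieldType) (n : nat).
Local Notation S := {mpoly K[n]}.
Implicit Types (F : {set 'I_n}) (f g : S) (I P : S -> Prop).

(** Setting the variables outside F to zero is an idempotent endomorphism of S. Its image serves as
    the polynomial ring in the variables of F, and its kernel is the prime of the face F. *)
Definition restr F : S -> S :=
  mmap (@mpolyC n K) (fun i => if i \in F then 'X_i else 0).

HB.instance Definition _ F := GRing.RMorphism.on (restr F).

Lemma restrC F c : restr F c%:MP = c%:MP. Proof. exact: mmapC. Qed.

Lemma restrX F i : restr F 'X_i = if i \in F then 'X_i else 0.
Proof. by rewrite /restr mmapX mmap1U. Qed.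

Lemma restrZ F c f : restr F (c *: f) = c *: restr F f.
Proof. by rewrite -!mul_mpolyC rmorphM /= restrC. Qed.

Lemma restr_congr I F f : is_ideal I -> (forall i, i \notin F -> I 'X_i) ->
  I (f - restr F f).
Proof.
move=> hI hF; case: (hI) => I0 ID IM; elim/mpoly_ring_ind: f => [c|i|f g hf hg|f g hf hg].
- by rewrite restrC subrr.
- by rewrite restrX; case: ifPn => [_|/hF]; rewrite ?subrr ?subr0.
- by rewrite rmorphD /= opprD addrACA; exact: ID.
- rewrite rmorphM /=.
  have -> : f * g - restr F f * restr F g =
      g * (f - restr F f) + restr F f * (g - restr F g) by ring.
  by apply: (ID); exact: IM.
Qed.

Lemma restr_restr F G f : restr F (restr G f) = restr (F :&: G) f.
Proof.
apply: (mpoly_rmorph_eq (f := restr F \o restr G)) => [c|i] /=.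
  by rewrite !restrC.
rewrite !restrX inE; case: (i \in G); last by rewrite andbF rmorph0.
by rewrite andbT restrX.
Qed.

Lemma restr_supp F f u i : u \in msupp (restr F f) -> i \notin F -> u i = 0%N.
Proof.
move=> + iF; move: u; elim/mpoly_ring_ind: f => [c|j|f g hf hg|f g hf hg] u.
- rewrite restrC msuppC; case: ifP => //= _; rewrite inE => /eqP->.
  exact: mnm0E.
- rewrite restrX; case: ifPn => jF; last by rewrite msupp0.
  rewrite msuppX inE => /eqP->; rewrite mnm1E; case: eqP => // ji.
  by rewrite ji (negPf iF) in jF.
- by rewrite rmorphD /= => /msuppD_le; rewrite mem_cat => /orP[/hf|/hg].
- rewrite rmorphM /= => /msuppM_le/allpairsP[[v w] /= [/hf hv /hg hw ->]].
  by rewrite mnmDE hv hw.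
Qed.

Definition var_ideal F : S -> Prop := fun f => restr F f = 0.

Lemma var_ideal_prime F : is_prime (var_ideal F).
Proof.
split; rewrite /var_ideal.
- split=> [|f g|a f]; rewrite ?rmorph0 ?rmorphD ?rmorphM //=.
    by move=> -> ->; rewrite addr0.
  by move=> ->; rewrite mulr0.
- by rewrite rmorph1; apply/eqP/oner_neq0.
- by move=> f g; rewrite rmorphM /= => /eqP; rewrite mulf_eq0 => /orP[]/eqP; [left|right].
Qed.

Lemma var_ideal_min F I f : is_ideal I -> (forall i, i \notin F -> I 'X_i) ->
  var_ideal F f -> I f.
Proof. by move=> hI hF e; have := restr_congr f hI hF; rewrite e subr0. Qed.

Lemma mem_var_ideal F i : var_ideal F 'X_i <-> i \notin F.
Proof.
rewrite /var_ideal restrX; case: (i \in F) => //=; split=> // /eqP.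
by rewrite -msupp_eq0 msuppX.
Qed.

(** * Lengths of chains of primes *)

Let deg_le f d := forall u, u \in msupp f -> (mdeg u <= d)%N.

Let deg_leM f g d e : deg_le f d -> deg_le g e -> deg_le (f * g) (d + e).
Proof.
move=> hf hg u /msuppM_le/allpairsP[[v w] /= [/hf hv /hg hw ->]].
by rewrite mdegD leq_add.
Qed.

Let deg_le1 : deg_le 1 0.
Proof. by move=> u; rewrite msupp1 inE => /eqP->; rewrite mdeg0. Qed.

Let deg_leX f d k : deg_le f d -> deg_le (f ^+ k) (k * d).
Proof.
move=> hf; elim: k => [|k IH]; first by rewrite expr0 mul0n.
by rewrite exprS mulSn; exact: deg_leM.
Qed.

Let deg_le_prod (I : Type) (r : seq I) (y : I -> S) (d : I -> nat) :
  (forall i, deg_le (y i) (d i)) -> deg_le (\prod_(i <- r) y i) (\sum_(i <- r) d i).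
Proof.
move=> h; elim/big_rec2: _ => [|i e f _ hf]; first exact: deg_le1.
exact: deg_leM.
Qed.

(* Comparing the number of monomials of bounded degree in [r.+1] and in [r]
   variables. *)
Lemma restr_alg_dependent F (y : 'I_#|F|.+1 -> S) :
  exists N (c : {ffun 'I_#|F|.+1 -> 'I_N} -> K), (exists a, c a != 0) /\
    restr F (\sum_a c a *: \prod_i y i ^+ a i) = 0.
Proof.
set r := #|F| in y *.
pose z i := restr F (y i).
pose D := \max_i \max_(u <- msupp (z i)) mdeg u.
have zD i : deg_le (z i) D.
  move=> u uz; apply: leq_trans (leq_bigmax i).
  exact: (@leq_bigmax_seq _ _ xpredT).
(* The N^(r+1) products with exponents below N have degree at most B and involve at most (B+1)^r
   monomials. Since B + 1 <= Ne, this is at most N^r e^r, and e^r < N: there are more products than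
   monomials. *)
pose e := (r.+1 * D).+1; pose N := (e ^ r).+1; pose B := (r.+1 * (N * D))%N.
pose C := [set b : {ffun 'I_n -> 'I_B.+1} | [forall i, (i \notin F) ==> (b i == ord0)]].
have cC : #|C| = (B.+1 ^ r)%N.
  have -> : (B.+1 ^ r = #|'I_B.+1| ^ #|F|)%N by rewrite card_ord.
  rewrite -(card_pffun_on ord0 (mem F) predT); apply: eq_card => b.
  rewrite inE; apply/forallP/pffun_onP => [h|[h _] i].
    split=> //; apply/subsetP => i; apply: contraR => iF.
    by move/implyP: (h i); apply.
  by apply/implyP; apply: contraR => bi; apply: (subsetP h).
pose mon (b : {ffun 'I_n -> 'I_B.+1}) : 'X_{1..n} := [multinom nat_of_ord (b i) | i < n].
pose w (a : {ffun 'I_r.+1 -> 'I_N}) := \prod_i z i ^+ a i.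
pose A := \matrix_(i < #|{: {ffun 'I_r.+1 -> 'I_N}}|, j < #|C|)
  (w (enum_val i))@_(mon (enum_val j)).
have lt : (#|C| < #|{: {ffun 'I_r.+1 -> 'I_N}}|)%N.
  rewrite cC card_ffun !card_ord.
  have le : (B.+1 <= N * e)%N by rewrite /B /e; nia.
  apply: (@leq_ltn_trans ((N * e) ^ r)%N).
    by case: (posnP r) => [->//|r0]; rewrite leq_exp2r.
  by rewrite expnMn expnSr ltn_pmul2l ?expn_gt0.
have : kermx A != 0.
  rewrite -mxrank_eq0 mxrank_ker subn_eq0 -ltnNge.
  exact: leq_ltn_trans (rank_leq_col A) lt.
case/rowV0Pn=> v /sub_kermxP vA v0.
exists N, (fun a => v ord0 (enum_rank a)); split.
  case/rV0Pn: v0 => i vi; exists (enum_val i); by rewrite enum_valK.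
apply/mpolyP => u; rewrite mcoeff0 rmorph_sum raddf_sum /=.
have zw a : restr F (v ord0 (enum_rank a) *: \prod_i y i ^+ a i) = v ord0 (enum_rank a) *: w a.
  rewrite restrZ rmorph_prod /=; congr (_ *: _); apply: eq_bigr => i _.
  by rewrite rmorphXn.
under eq_bigr => a _ do rewrite zw mcoeffZ.
have [/existsP[b /andP[bC /eqP <-]]|hu] := boolP [exists b, (b \in C) && (mon b == u)].
  have := congr1 (fun M : 'rV_#|C| => M ord0 (enum_rank_in bC b)) vA.
  rewrite !mxE => h; apply: etrans h.
  rewrite (reindex_onto enum_rank enum_val) => [|i _]; last exact: enum_valK.
  apply: eq_big => [a|a _]; first by rewrite enum_rankK eqxx.
  by rewrite mxE enum_rankK enum_rankK_in.
apply: big1 => a _; apply/eqP; rewrite mulf_eq0; apply/orP; right.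
rewrite mcoeff_eq0; apply: contra hu => uw.
have uB i : (u i < B.+1)%N.
  have : deg_le (w a) B.
    have -> : B = (\sum_(i < r.+1) (N * D))%N by rewrite sum_nat_const card_ord.
    apply: deg_le_prod => j v' /(deg_leX (zD j)) h; apply: leq_trans h _.
    by rewrite leq_mul2r (ltnW (ltn_ord _)) orbT.
  move=> /(_ u uw); rewrite ltnS; apply: leq_trans.
  by rewrite mdegE (bigD1 i) //= leq_addr.
have uF i : i \notin F -> u i = 0%N.
  apply: restr_supp (_ : u \in msupp (restr F (\prod_i y i ^+ a i))).
  rewrite rmorph_prod /=; move: uw; congr (u \in msupp _); apply: eq_bigr => j _.
  by rewrite rmorphXn.
apply/existsP; exists [ffun i => Ordinal (uB i)]; apply/andP; split.
  rewrite inE; apply/forallP => i; apply/implyP => iF; rewrite ffunE.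
  by apply/eqP/val_inj; exact: uF.
by apply/eqP/mnmP => i; rewrite mnmE ffunE.
Qed.

(* The lowest terms of an algebraic relation between elements [y_i] of
   [P_(i+1)] outside [P_i]. *)
Lemma pchain_alg_independent r N (P : nat -> S -> Prop) (y : 'I_r -> S)
    (c : {ffun 'I_r -> 'I_N} -> K) :
  (forall i, is_prime (P i)) ->
  (forall i : 'I_r, [/\ forall f, P i f -> P i.+1 f, P i.+1 (y i) & ~ P i (y i)]) ->
  (exists a, c a != 0) -> ~ P 0%N (\sum_a c a *: \prod_i y i ^+ a i).
Proof.
move=> hP hy [a0 ca0] h0.
pose rest j a := \prod_(i < r | (j <= i)%N) y i ^+ (a i : 'I_N).
(* E keeps the exponents that are successively least in the first j coordinates. For the next stage
   a power of y_j is cancelled, as y_j is outside P_j, and the terms still divisible by y_j are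
   dropped, as y_j is in P_(j+1). In the end a nonzero constant would lie in P_r. *)
have low j : (j <= r)%N -> exists E : {set {ffun 'I_r -> 'I_N}},
    [/\ exists a, a \in E, forall a, a \in E -> c a != 0,
     forall a b (i : 'I_r), a \in E -> b \in E -> (i < j)%N -> a i = b i &
     P j (\sum_(a in E) c a *: rest j a)].
  elim: j => [_|j IH jr].
    exists [set a | c a != 0]; split=> [|a|//|].
    - by exists a0; rewrite inE.
    - by rewrite inE.
    - move: h0; congr (P _ _); rewrite [LHS](bigID (fun a => c a != 0)) /=.
      rewrite [X in _ + X]big1 => [|a]; last by rewrite negbK => /eqP->; rewrite scale0r.
      by rewrite addr0; apply: eq_big => a; rewrite ?inE.
  have [E [[a1 a1E] Ec Eq PE]] := IH (ltnW jr).
  pose o := Ordinal jr.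
  have [a2 a2E amin] : exists2 a2, a2 \in E & forall a, a \in E -> (a2 o <= a o)%N.
    by case: (arg_minnP (fun a : {ffun 'I_r -> 'I_N} => nat_of_ord (a o)) a1E) => a2; exists a2.
  exists [set a in E | a o == a2 o]; split.
  - by exists a2; rewrite inE a2E eqxx.
  - by move=> a; rewrite inE => /andP[/Ec].
  - move=> a b i; rewrite !inE => /andP[aE /eqP ea] /andP[bE /eqP eb].
    rewrite ltnS leq_eqVlt => /orP[/eqP ij|]; last exact: Eq.
    have -> : i = o by apply: val_inj.
    by rewrite ea eb.
  have restS a : rest j a = y o ^+ a o * rest j.+1 a.
    rewrite /rest (bigD1 o) //=; congr (_ * _); apply: eq_bigl => i.
    by rewrite ltn_neqAle -val_eqE /= eq_sym andbC.
  have [Pj yS yN] := hy o; rewrite /= in Pj yS yN.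
  have hj := hP j; have hj1 := hP j.+1.
  pose u := \sum_(a in E | a o != a2 o) c a *: (y o ^+ (a o - a2 o).-1 * rest j.+1 a).
  have e : \sum_(a in E) c a *: rest j a =
      y o ^+ a2 o * (\sum_(a in [set a in E | a o == a2 o]) c a *: rest j.+1 a + y o * u).
    rewrite mulrDr (bigID (fun a : {ffun _ -> _} => a o == a2 o)) /=; congr (_ + _).
      rewrite mulr_sumr; apply: eq_big => a; first by rewrite inE.
      by move=> /andP[_ /eqP ea]; rewrite restS ea scalerAr.
    rewrite mulrA -exprSr mulr_sumr; apply: eq_bigr => a /andP[aE ne].
    rewrite -scalerAr mulrA -exprD restS; congr (_ *: (_ ^+ _ * _)).
    have ne' : a o <> a2 o :> nat by move=> /val_inj h; rewrite h eqxx in ne.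
    have := amin a aE; move: ne'; move: (nat_of_ord (a o)) (nat_of_ord (a2 o)) => p q.
    lia.
  move: PE; rewrite e; case: (hj) => _ _ hM /hM[/(is_primeX hj)//|/Pj].
  case: (hj1) => hI _ _ h; rewrite -[X in P _ X](addrK (y o * u)).
  by apply: is_idealB => //; exact: is_idealMr.
have [E [[a aE] Ec Eq PE]] := low r (leqnn r).
have eE : E = [set a].
  apply/setP => b; rewrite inE; apply/idP/eqP => [bE|->//].
  by apply/ffunP => i; apply: Eq.
move: PE; rewrite eE big_set1 /rest big1 => [|i]; last by rewrite leqNgt ltn_ord.
have [[_ _ hM] h1 _] := hP r; move=> /(hM (c a)^-1%:MP); rewrite mul_mpolyC scalerA.
by rewrite mulVf ?Ec ?aE // scale1r.
Qed.

Lemma pchain_bound F k (P : nat -> S -> Prop) : pchain k P ->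
  (forall f, var_ideal F f -> P 0%N f) -> (k <= #|F|)%N.
Proof.
move=> [hP hk] PF; rewrite leqNgt; apply/negP => lt.
have /choice[y hy] : forall i : 'I_#|F|.+1, exists g,
    [/\ forall f, P i f -> P i.+1 f, P i.+1 g & ~ P i g].
  move=> i; have [|h1 [f h2 h3]] := hk i; last by exists f.
  exact: leq_trans (ltn_ord i) lt.
have [N [c [hc e]]] := restr_alg_dependent y.
by apply: (pchain_alg_independent hP hy hc); apply: PF.
Qed.

End Restriction.

(** * Zariski's lemma *)

(** For degree N + 1 and leading coefficient e, multiplying the equation of x by e^N turns it into a
    monic equation of ex. *)
Lemma integral_lead_coef (A L : comNzRingType) (phi : {rmorphism A -> L})
    (p : {poly A}) (x : L) :
  root (map_poly phi p) x -> integralOver phi (phi (lead_coef p) * x).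
Proof.
have [->|p0] := eqVneq p 0.
  by rewrite lead_coef0 !rmorph0 mul0r => _; exact: integral0.
move=> px; set e := lead_coef p; have := p0; rewrite -size_poly_gt0.
case sp: (size p) => [//|[|N]] _.
  have pe : p = e%:P by rewrite /e lead_coefE sp; apply: size1_polyC; rewrite sp.
  have -> : phi e = 0 by apply/eqP; rewrite -(rootC _ x) -map_polyC -pe.
  by rewrite mul0r; exact: integral0.
pose m := 'X^(N.+1) + \poly_(k < N.+1) (p`_k * e ^+ (N - k)).
have sm : (size (\poly_(k < N.+1) (p`_k * e ^+ (N - k)))%R < size ('X^(N.+1) : {poly A})%R)%N.
  by rewrite size_polyXn ltnS size_poly.
exists m; first by rewrite monicE /m lead_coefDl // lead_coefXn.
apply/eqP; rewrite /m rmorphD /= map_polyXn hornerD hornerXn.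
have -> : map_poly phi (\poly_(k < N.+1) (p`_k * e ^+ (N - k))) =
    \poly_(k < N.+1) (phi p`_k * phi e ^+ (N - k)).
  apply/polyP => k; rewrite coef_map !coef_poly; case: ifP => _; last by rewrite /= rmorph0.
  by rewrite /= rmorphM rmorphXn.
rewrite horner_poly; move/eqP: px => px.
have : \sum_(k < N.+2) phi p`_k * x ^+ k = 0.
  rewrite -[RHS]px; rewrite (@horner_coef_wide _ N.+2) ?(leq_trans (size_poly _ _)) ?sp //.
  by apply: eq_bigr => k _; rewrite coef_map.
rewrite big_ord_recr /= => /(congr1 (fun t => phi e ^+ N * t)).
have -> : p`_N.+1 = e by rewrite /e lead_coefE sp.
rewrite mulr0 mulrDr mulr_sumr addrC => h; rewrite -[RHS]h; congr (_ + _).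
  by rewrite exprMn exprSr; ring.
apply: eq_bigr => k _; rewrite exprMn.
have -> : phi e ^+ N = phi e ^+ (N - k) * phi e ^+ k.
  by rewrite -exprD subnK // -ltnS.
ring.
Qed.

Section Zariski.
Variables (K : fieldType) (n : nat).
Local Notation S := {mpoly K[n]}.
Variable q : S -> Prop.
Hypotheses (hq : is_prime q) (qmax : forall f, ~ q f -> exists g, q (f * g - 1)).
Implicit Types (Y : {set 'I_n}) (f g e : S).

(** Algebraic independence over K of the classes in S/q of the variables in Y. *)
Definition var_indep Y : Prop := forall f, q (restr Y f) -> restr Y f = 0.

Lemma restr0E f : restr set0 f = ((restr set0 f)@_0)%:MP.
Proof.
apply: msize1_polyC; rewrite msizeE; apply/bigmax_leqP_seq => u uf _.
suff -> : u = 0%MM by rewrite mdeg0.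
by apply/mnmP => i; rewrite mnm0E (restr_supp uf) ?inE.
Qed.

Lemma const_notin c : q c%:MP -> c = 0.
Proof.
move=> qc; apply/eqP; apply: contraT => c0; have [hI q1 _] := hq.
case: q1; case: hI => _ _ /(_ c^-1%:MP _ qc).
by rewrite -mpolyCM mulVf // mpolyC1.
Qed.

Lemma var_indep0 : var_indep set0.
Proof. by move=> f; rewrite restr0E => /const_notin->; rewrite mpolyC0. Qed.

(* [f], restricted to the variables in [i |: Y], as a polynomial in [X_i]. *)
Definition poly_in Y (i : 'I_n) : S -> {poly S} :=
  mmap (polyC \o @mpolyC n K)
    (fun j => if j \in Y then ('X_j)%:P else if j == i then 'X else 0).

HB.instance Definition _ Y i := GRing.RMorphism.on (poly_in Y i).

Lemma poly_inC Y i c : poly_in Y i c%:MP = c%:MP%:P. Proof. exact: mmapC. Qed.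

Lemma poly_inX Y i j : poly_in Y i 'X_j =
  if j \in Y then ('X_j)%:P else if j == i then 'X else 0.
Proof. by rewrite /poly_in mmapX mmap1U. Qed.

Lemma horner_poly_in Y i f : (poly_in Y i f).['X_i] = restr (i |: Y) f.
Proof.
apply: (mpoly_rmorph_eq (f := horner_eval 'X_i \o poly_in Y i)) => [c|j] /=.
  by rewrite poly_inC restrC /horner_eval hornerC.
rewrite poly_inX restrX !inE /horner_eval orbC; case: (j \in Y); rewrite /= ?hornerC //.
by case: eqP => [->|_]; rewrite ?hornerX ?horner0.
Qed.

Lemma coef_poly_in Y i f k : restr Y (poly_in Y i f)`_k = (poly_in Y i f)`_k.
Proof.
suff e : map_poly (restr Y) (poly_in Y i f) = poly_in Y i f by rewrite -{2}e coef_map.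
apply: (mpoly_rmorph_eq (f := map_poly (restr Y) \o poly_in Y i)) => [c|j] /=.
  by rewrite poly_inC map_polyC /= restrC.
rewrite poly_inX; case: ifP => jY; first by rewrite map_polyC /= restrX jY.
by case: ifP => _; rewrite ?map_polyX ?rmorph0.
Qed.

Lemma var_dep_poly Y i : ~ var_indep (i |: Y) ->
  exists p : {poly S}, [/\ p != 0, forall k, restr Y p`_k = p`_k & q p.['X_i]].
Proof.
move=> h; have [f qf f0] : exists2 f, q (restr (i |: Y) f) & restr (i |: Y) f != 0.
  apply: contrapT => hno; apply: h => f qf; apply/eqP; apply: contraT => f0.
  by case: hno; exists f.
exists (poly_in Y i f); split=> [|k|]; rewrite ?horner_poly_in ?coef_poly_in //.
by apply: contraNneq f0 => e; rewrite -horner_poly_in e horner0.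
Qed.

(** Put a = 1 + X_j e. Modulo [a] the power (X_j e)^m is (-1)^m, so if [a] divided e^m it would be a
    unit, hence constant. Then X_j e would be a constant, and setting X_j to zero shows that it
    would vanish. *)
Lemma one_addX_not_dvd Y (j : 'I_n) e m b : restr Y e = e -> e != 0 -> j \in Y ->
  e ^+ m <> (1 + 'X_j * e) * b.
Proof.
set a := 1 + _ => eY e0 jY em.
have [b' hb'] : exists b', a * b' = 1.
  have [t ht] : exists t, (a - 1) ^+ m = a * t.
    by exists ('X_j ^+ m * b); rewrite {1}/a addrC addKr exprMn em; ring.
  have [u hu] : exists u, (a - 1) ^+ m = a * u + (-1) ^+ m.
    elim: (m) => [|k [u hu]]; first by exists 0; rewrite !expr0 mulr0 add0r.
    by exists ((a - 1) * u + (-1) ^+ k); rewrite !exprS hu; ring.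
  exists ((-1) ^+ m * (t - u)).
  have -> : a * ((-1) ^+ m * (t - u)) = (-1) ^+ m * (a * t - a * u) by ring.
  by rewrite -ht hu addrAC subrr add0r -expr2 sqrr_sign.
have a0 : a != 0 by apply: contra_eq_neq hb' => ->; rewrite mul0r eq_sym oner_neq0.
have b0 : b' != 0 by apply: contra_eq_neq hb' => ->; rewrite mulr0 eq_sym oner_neq0.
have sa1 : (msize a <= 1)%N.
  have b1 : (0 < msize b')%N by rewrite lt0n mmeasure_poly_eq0.
  by have := msizeM a0 b0; rewrite hb' msize1; move: b1; move: (msize a) (msize b'); lia.
have ac := msize1_polyC sa1.
have : restr (~: [set j]) ('X_j * e) = 'X_j * e.
  have -> : 'X_j * e = (a@_0 - 1)%:MP by rewrite rmorphB /= mpolyC1 -ac /a; ring.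
  by rewrite restrC.
rewrite rmorphM /= restrX !inE eqxx mul0r => /esym/eqP; rewrite mulf_eq0 (negPf e0) orbF.
by rewrite -msupp_eq0 msuppX.
Qed.

(** By maximality there is one nonzero e in K[Y] such that every element of S, times a power of e,
    is integral over K[Y] modulo q. For j in Y, applying this to the inverse of 1 + X_j e in the
    field S/q makes 1 + X_j e divide a power of e. *)
Lemma var_indep_max Y : var_indep Y ->
  (forall i, i \notin Y -> ~ var_indep (i |: Y)) -> Y = set0.
Proof.
move=> hY hmax; apply/eqP; apply: contraT => /set0Pn[j jY].
have [hI q1 _] := hq; have [Q hQ] := is_ideal_idealr hI q1.
have [L [pi lq]] : exists (L : comNzRingType) (pi : {rmorphism S -> L}),
    locquo (fun f => f = 1) (fun f => f \in Q) pi.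
  by exists {ideal_quot Q}, (\pi_{ideal_quot Q})%qT; exact: ideal_quot_locquo.
have piE f : pi f = 0 <-> q f.
  rewrite (locquo_ker lq) -hQ; split=> [[_ ->]|h]; first by rewrite mul1r.
  by exists 1; rewrite ?mul1r.
have [phi phiE] : exists phi : {rmorphism S -> L}, forall f, phi f = pi (restr Y f).
  by exists (pi \o restr Y).
have he i : exists e, [/\ restr Y e = e, e != 0 & integralOver phi (phi e * pi 'X_i)].
  have [iY|iY] := boolP (i \in Y).
    exists 1; rewrite rmorph1 oner_neq0 rmorph1 mul1r; split=> //.
    have -> : pi 'X_i = phi 'X_i by rewrite phiE restrX iY.
    exact: integral_id.
  have [p [p0 pY qp]] := var_dep_poly (hmax i iY).
  exists (lead_coef p); rewrite lead_coef_eq0 p0 lead_coefE pY; split=> //.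
  rewrite -lead_coefE; apply: integral_lead_coef; apply/eqP.
  have -> : map_poly phi p = map_poly pi p.
    by apply/polyP => k; rewrite !coef_map /= phiE pY.
  by rewrite horner_map; apply/piE.
have [e_ he_] := choice he.
pose e := \prod_i e_ i.
have eY : restr Y e = e.
  by rewrite rmorph_prod; apply: eq_bigr => i _; case: (he_ i).
have e0 : e != 0 by apply/prodf_neq0 => i _; case: (he_ i).
have heX i : integralOver phi (phi e * pi 'X_i).
  rewrite /e (bigD1 i) //= rmorphM mulrAC; apply: integral_mul; last exact: integral_id.
  by case: (he_ i).
have hef f : exists k, integralOver phi (phi e ^+ k * pi f).
  elim/mpoly_ring_ind: f => [c|i|f g [k hf] [l hg]|f g [k hf] [l hg]].
  - exists 0; rewrite mul1r; have -> : pi c%:MP = phi c%:MP by rewrite phiE restrC.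
    exact: integral_id.
  - by exists 1.
  - exists (k + l)%N; rewrite rmorphD.
    have -> : phi e ^+ (k + l) * (pi f + pi g) =
      phi (e ^+ l) * (phi e ^+ k * pi f) + phi (e ^+ k) * (phi e ^+ l * pi g).
      by rewrite !rmorphXn exprD; ring.
    by apply: integral_add; apply: integral_mul => //; exact: integral_id.
  - exists (k + l)%N; rewrite rmorphM exprD mulrACA; exact: integral_mul.
pose a := 1 + 'X_j * e.
have aY : restr Y a = a by rewrite /a rmorphD rmorph1 rmorphM /= restrX jY eY.
have a0 : a != 0.
  apply/eqP => /(congr1 (restr set0)).
  rewrite /a rmorphD rmorph1 rmorphM /= restrX inE mul0r addr0 rmorph0.
  by apply/eqP/oner_neq0.
have [g qg] : exists g, q (a * g - 1).
  by apply: qmax => qa; move/eqP: a0; apply; rewrite -aY; apply: hY; rewrite aY.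
have ag : pi a * pi g = 1.
  by apply/eqP; rewrite -subr_eq0 -rmorphM -(rmorph1 pi) -rmorphB; apply/eqP/piE.
have [k [p mp /eqP pg]] := hef g.
pose N := (size p).-1.
have sp : size p = N.+1 by rewrite /N prednK // size_poly_gt0 monic_neq0.
(* This comes from the monic equation of e^k g multiplied by a^N, using ag = 1: the leading term
   becomes e^(kN), and all others keep a factor [a]. *)
pose t := \sum_(i < N) p`_i * e ^+ (k * i) * a ^+ (N - i).-1.
have : phi (a * t + e ^+ (k * N)) = 0.
  rewrite -[RHS](mulr0 (phi a ^+ N)) -pg horner_coef.
  rewrite size_map_poly_id0; last by rewrite (monicP mp) rmorph1 oner_neq0.
  rewrite sp big_ord_recr /= mulrDr rmorphD rmorphM rmorph_sum.
  have phia : phi a = pi a by rewrite phiE aY.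
  have key i : (i <= N)%N ->
      phi a ^+ N * (phi e ^+ k * pi g) ^+ i = phi (e ^+ (k * i) * a ^+ (N - i)).
    move=> iN; rewrite exprMn rmorphM !rmorphXn exprM mulrCA; congr (_ * _).
    have -> : phi a ^+ N = phi a ^+ (N - i) * phi a ^+ i by rewrite -exprD subnK.
    by rewrite -mulrA -exprMn phia ag expr1n mulr1.
  congr (_ + _); last first.
    rewrite coef_map; have -> : p`_N = 1 by rewrite -(monicP mp) lead_coefE.
    by rewrite /= rmorph1 mul1r key // subnn mulr1.
  rewrite !mulr_sumr; apply: eq_bigr => i _.
  rewrite coef_map mulrCA key 1?ltnW // -!rmorphM; congr (phi _).
  have -> : (N - i)%N = (N - i).-1.+1 by have := ltn_ord i; lia.
  by rewrite exprS /=; ring.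
rewrite phiE => /piE/hY; rewrite rmorphD rmorphM rmorphXn /= eY aY addrC => /eqP.
rewrite addr_eq0 -mulrN => /eqP h.
by case: (one_addX_not_dvd eY e0 jY h).
Qed.

(** A largest independent set of variables is empty by [var_indep_max], so each variable is
    algebraic over K modulo q. *)
Lemma zariski i : exists2 g : {poly K}, g \is monic & q (map_poly (@mpolyC n K) g).['X_i].
Proof.
case: (arg_maxnP (P := fun Y => `[< var_indep Y >]) (fun Y => #|Y|) (i0 := set0)).
  exact/asboolP/var_indep0.
move=> Y /asboolP hY Ymax.
have Y0 : Y = set0.
  apply: var_indep_max => // j jY /asboolP/Ymax.
  by rewrite /= cardsU1 jY add1n ltnn.
have [p [p0 pY qp]] : exists p : {poly S}, [/\ p != 0, forall k, restr Y p`_k = p`_k & q p.['X_i]].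
  by apply: var_dep_poly => /asboolP/Ymax; rewrite cardsU1 Y0 inE cards0.
pose g := map_poly (mcoeff 0%MM) p.
have pg : map_poly (@mpolyC n K) g = p.
  by apply/polyP => k; rewrite !coef_map /= -pY Y0 -restr0E.
have g0 : g != 0 by apply: contraNneq p0 => e; rewrite -pg e map_poly0.
exists ((lead_coef g)^-1 *: g); first by rewrite monicE lead_coefZ mulVf ?lead_coef_eq0.
rewrite map_polyZ pg hornerZ; case: hq => -[_ _ hM] _ _.
exact: hM.
Qed.

End Zariski.

(** * Regularity of elementary symmetric functions *)

(** With x one factor and y the product of the others, (I + (xy)) : x = I + (y) because x is a
    nonzerodivisor, and adjoining x to I + (xy) gives I + (x). So [wreg_colon] splits off one factor
    at a time, down to the unit ideal. *)
Lemma wreg_adjoin_prod (R : comNzRingType) (I : R -> Prop) (A : eqType)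
    (r : seq A) (h : A -> R) (s : seq R) : is_ideal I ->
  (forall i, i \in r -> forall f, I (h i * f) -> I f) ->
  (forall i, i \in r -> wreg (adjoin I (h i)) s) ->
  wreg (adjoin I (\prod_(i <- r) h i)) s.
Proof.
move=> hI; elim: r => [|i r IH] hr hs.
  rewrite big_nil; apply: wreg_full => f.
  by exists f; rewrite mulr1 subrr; case: hI.
rewrite big_cons; set x := h i; set y := \prod_(_ <- _) _.
have hxy := adjoin_ideal (x * y) hI.
apply: (wreg_colon (x := x) hxy).
  have -> : (fun f => adjoin I (x * y) (x * f)) = adjoin I y.
    apply: pred_eq => f; split=> -[c hc]; exists c.
      apply: (hr i (mem_head _ _)); move: hc; congr (I _); rewrite -/x; ring.
    by case: hI => _ _ /(_ x _ hc); congr (I _); ring.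
  by apply: IH => j jr; [apply: hr | apply: hs]; rewrite inE jr orbT.
suff -> : adjoin (adjoin I (x * y)) x = adjoin I x by apply: hs; rewrite mem_head.
apply: pred_eq => f; split; last first.
  apply: adjoin_min; [exact: adjoin_ideal | | exact: mem_adjoin].
  by move=> g hg; do 2!apply: sub_adjoin.
have hx := adjoin_ideal x hI; apply: adjoin_min => //; last exact: mem_adjoin.
apply: adjoin_min => //; first by move=> g; exact: sub_adjoin.
by apply: is_idealMr => //; exact: mem_adjoin.
Qed.

(** Over R/J a nonzero multiple of a monic polynomial cannot be shorter than it. *)
Lemma monic_mod_ideal (R : comNzRingType) (J : R -> Prop) (p g v : {poly R}) :
  is_ideal J -> g \is monic -> (size p < size g)%N ->
  (forall k, J (p - v * g)`_k) -> forall k, J p`_k.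
Proof.
move=> hJ mg sp hk k; have [J1|J1] := pselect (J 1).
  by rewrite -[p`_k]mulr1; case: hJ => _ _; apply.
have [Q hQ] := is_ideal_idealr hJ J1.
have [L [pi lq]] : exists (L : comNzRingType) (pi : {rmorphism R -> L}),
    locquo (fun f => f = 1) (fun f => f \in Q) pi.
  by exists {ideal_quot Q}, (\pi_{ideal_quot Q})%qT; exact: ideal_quot_locquo.
have piE f : pi f = 0 <-> J f.
  rewrite (locquo_ker lq) -hQ; split=> [[_ ->]|h]; first by rewrite mul1r.
  by exists 1; rewrite ?mul1r.
have e : map_poly pi p = map_poly pi v * map_poly pi g.
  apply/eqP; rewrite -subr_eq0 -rmorphM -rmorphB; apply/eqP/polyP => i.
  by rewrite coef0 coef_map; apply/piE.
have mpg : map_poly pi g \is monic by exact: monic_map.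
have sg : size (map_poly pi g) = size g.
  by rewrite size_map_poly_id0 // (monicP mg) rmorph1 oner_neq0.
have v0 : map_poly pi v = 0.
  apply/eqP; apply: contraT => v0; have : (size (map_poly pi p) < size g)%N.
    exact: leq_ltn_trans (size_poly _ _) sp.
  rewrite e size_Mmonic // sg.
  have := v0; rewrite -size_poly_gt0; move: (size _) (size g) => a b; lia.
by apply/piE; rewrite -coef_map e v0 mul0r coef0.
Qed.

Section UnivariateIdeal.
Variables (K : fieldType) (n : nat).
Local Notation S := {mpoly K[n]}.
Implicit Types (f h : S) (Z : {set 'I_n}) (i j : 'I_n).

Definition univ (p : {poly K}) i : S := (map_poly (@mpolyC n K) p).['X_i].

Lemma univM p q i : univ (p * q) i = univ p i * univ q i.
Proof. by rewrite /univ rmorphM hornerM. Qed.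

Lemma univX i : univ 'X i = 'X_i.
Proof. by rewrite /univ map_polyX hornerX. Qed.

Lemma restrT f : restr setT f = f.
Proof.
apply: (mpoly_rmorph_eq (g := idfun)) => [c|i] /=; first exact: restrC.
by rewrite restrX inE.
Qed.

(** The coefficients are free of X_i, so an element of [uni_ideal Z] with i outside Z has all its
    coefficients in that ideal. *)
Definition polyat i : S -> {poly S} := poly_in (~: [set i]) i.

HB.instance Definition _ i := GRing.RMorphism.copy (polyat i) (poly_in (~: [set i]) i).

Lemma horner_polyat i f : (polyat i f).['X_i] = f.
Proof. by rewrite /polyat horner_poly_in setUCr restrT. Qed.

Lemma polyat_univ i p j : polyat i (univ p j) =
  if j == i then map_poly (@mpolyC n K) p else (univ p j)%:P.
Proof.
rewrite /polyat /univ -horner_map -map_poly_comp.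
have -> : map_poly (poly_in (~: [set i]) i \o @mpolyC n K) p =
    map_poly polyC (map_poly (@mpolyC n K) p).
  by rewrite -map_poly_comp; apply: eq_map_poly => c /=; rewrite poly_inC.
rewrite /= poly_inX !inE; have [_|ji] := eqVneq j i; last by rewrite horner_map.
by rewrite -[RHS]comp_polyXr.
Qed.

Variable g : 'I_n -> {poly K}.
Hypothesis mg : forall i, g i \is monic.

Definition uni_ideal Z : S -> Prop :=
  ideal_gen (fun f => exists2 i, i \in Z & f = univ (g i) i).

Lemma uni_ideal_ideal Z : is_ideal (uni_ideal Z).
Proof. exact: ideal_gen_ideal. Qed.

Lemma mem_uni_ideal Z i : i \in Z -> uni_ideal Z (univ (g i) i).
Proof. by move=> iZ; apply: sub_ideal_gen; exists i. Qed.

Lemma uni_idealU Z i : uni_ideal (i |: Z) = adjoin (uni_ideal Z) (univ (g i) i).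
Proof.
have hZ := uni_ideal_ideal Z; apply: pred_eq => f; split.
  apply: ideal_gen_min; first exact: adjoin_ideal.
  move=> _ [j + ->]; rewrite !inE => /orP[/eqP->|jZ]; first exact: mem_adjoin.
  by apply: sub_adjoin; exact: mem_uni_ideal.
apply: adjoin_min; first exact: uni_ideal_ideal.
  apply: ideal_gen_min; first exact: uni_ideal_ideal.
  by move=> _ [j jZ ->]; apply: mem_uni_ideal; rewrite inE jZ orbT.
by apply: mem_uni_ideal; rewrite setU11.
Qed.

Lemma uni_ideal0 f : uni_ideal set0 f <-> f = 0.
Proof.
split=> [hf|->]; last by case: (uni_ideal_ideal set0).
by have := ideal_gen_min (zero_ideal S) _ hf; apply=> y [i]; rewrite inE.
Qed.

(* Division by the monic polynomial [g i], in the variable [X_i]. *)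
Lemma univ_regular Z j : j \notin Z ->
  forall f, uni_ideal Z (univ (g j) j * f) -> uni_ideal Z f.
Proof.
have [m] := ubnP #|Z|; elim: m Z => // m IH Z; rewrite ltnS => Zm jZ f.
have [Z0|[i iZ]] := set_0Vmem Z.
  rewrite Z0 => /uni_ideal0/eqP; rewrite mulf_eq0 => /orP[|/eqP]; last by move/uni_ideal0.
  move=> /eqP/(congr1 (polyat j)); rewrite polyat_univ eqxx [RHS]rmorph0 => e.
  have := monic_neq0 (monic_map (@mpolyC n K) (mg j)).
  by rewrite e eqxx.
pose Z' := Z :\ i; have iZ' : i \notin Z' by rewrite !inE eqxx.
have jZ' : j \notin Z' by apply: contra jZ; rewrite inE => /andP[].
have ji : j != i by apply: contraNneq jZ => ->.
have cZ' : (#|Z'| < m)%N by move: Zm; rewrite (cardsD1 i) iZ.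
rewrite -(setD1K iZ) -/Z' uni_idealU => -[c hc].
have hZ' := uni_ideal_ideal Z'.
have coefJ u : uni_ideal Z' u -> forall k, uni_ideal Z' (polyat i u)`_k.
  have hI : is_ideal (fun u => forall k, uni_ideal Z' (polyat i u)`_k).
    case: (hZ') => h0 hD hM; split=> [k|u1 u2 h1 h2 k|b u1 h1 k].
    - by rewrite rmorph0 coef0.
    - by rewrite rmorphD coefD; exact: (hD _ _ (h1 k) (h2 k)).
    - by rewrite rmorphM coefM; apply: is_ideal_sum => // l _; exact: (hM _ _ (h1 _)).
  have := ideal_gen_min hI; apply=> _ [l lZ ->] k.
  have li : l != i by apply: contraNneq iZ' => <-.
  rewrite polyat_univ (negPf li) coefC; case: ifP => _; last by case: hZ'.
  exact: mem_uni_ideal.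
pose G := map_poly (@mpolyC n K) (g i).
have mG : G \is monic by exact: monic_map.
pose F := polyat i f; pose Q := Pdiv.Ring.rdivp F G; pose r := Pdiv.Ring.rmodp F G.
have FE : F = Q * G + r by exact: Pdiv.RingMonic.rdivp_eq.
have sr : (size r < size G)%N by rewrite Pdiv.Ring.ltn_rmodpN0 // monic_neq0.
pose H := univ (g j) j.
(* H is free of X_i, so modulo Z' the product Hr is a multiple of the monic G and shorter than it.
   Its coefficients therefore lie in the ideal of Z', and induction cancels H. *)
have hr k : uni_ideal Z' (H%:P * r)`_k.
  apply: (@monic_mod_ideal _ _ _ G (polyat i c - H%:P * Q)) => // [|l].
    by apply: leq_ltn_trans sr; rewrite mul_polyC size_scale_leq.
  have := coefJ _ hc l; rewrite rmorphB !rmorphM /=.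
  rewrite !polyat_univ eqxx (negPf ji) -/G -/F FE; congr (uni_ideal _ _`__).
  by rewrite -/H mulrBl opprB addrA mulrDr mulrA; rewrite [X in X - _]addrC.
have rJ k : uni_ideal Z' r`_k.
  by apply: (IH _ cZ' jZ'); have := hr k; rewrite coefCM.
exists Q.['X_i].
have -> : f - Q.['X_i] * univ (g i) i = r.['X_i].
  by rewrite -[f](horner_polyat i) -/F FE hornerD hornerM addrAC subrr add0r.
rewrite horner_coef; apply: is_ideal_sum => // k _; exact: is_idealMr.
Qed.

Variable h : 'I_n -> S.

Definition elem_sym k : S := \sum_(A : {set 'I_n} | #|A| == k) \prod_(i in A) h i.

Fixpoint elem_syms k : seq S :=
  if k is k'.+1 then elem_sym k :: elem_syms k' else [::].

Lemma size_elem_syms k : size (elem_syms k) = k.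
Proof. by elim: k => //= k ->. Qed.

Lemma mem_elem_syms (I : S -> Prop) k a : is_ideal I -> (forall i, I (h i)) ->
  a \in elem_syms k -> I a.
Proof.
move=> hI hh; elim: k => // k IH; rewrite inE => /orP[/eqP->|/IH//].
apply: is_ideal_sum => // A /eqP cA.
have /card_gt0P[i iA] : (0 < #|A|)%N by rewrite cA.
by rewrite (bigD1 i) //=; exact: is_idealMr.
Qed.

(* Modulo the ideal of [Z], the first function is the product of the remaining
   [h j], which lets one adjoin a single [h j] at a time. *)
Lemma wreg_elem_syms Z0 Z : (forall i, uni_ideal [set i] (h i)) ->
  (forall i, i \notin Z0 -> h i = univ (g i) i) -> Z0 \subset Z ->
  wreg (uni_ideal Z) (elem_syms #|~: Z|).
Proof.
move=> hh hg; have [m] := ubnP #|~: Z|; elim: m Z => // m IH Z Zm Z0Z.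
case cZ: #|~: Z| => [|k]; first exact: wreg_nil.
have hZ := uni_ideal_ideal Z.
have hin i : i \in Z -> uni_ideal Z (h i).
  move=> iZ; have := ideal_gen_min hZ; apply; last exact: (hh i).
  by move=> _ [j + ->]; rewrite inE => /eqP->; exact: mem_uni_ideal.
have hout i : i \notin Z -> h i = univ (g i) i.
  by move=> iZ; apply: hg; apply: contra iZ; exact: (subsetP Z0Z).
(* Any other set of k + 1 indices meets Z, which puts its product in the ideal. *)
have eE : uni_ideal Z (elem_sym k.+1 - \prod_(i in ~: Z) h i).
  rewrite /elem_sym (bigD1 (~: Z)) ?cZ //= addrAC subrr add0r.
  apply: is_ideal_sum => // A /andP[/eqP cA AZ].
  have /subsetPn[i iA] : ~~ (A \subset ~: Z).
    by apply: contra AZ => sA; rewrite eqEcard sA cZ cA /=.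
  rewrite inE negbK => iZ; rewrite (bigD1 i) //=.
  by apply: is_idealMr => //; exact: hin.
have creg i : i \in enum (~: Z) -> forall f, uni_ideal Z (h i * f) -> uni_ideal Z f.
  by rewrite mem_enum inE => iZ; rewrite hout //; exact: univ_regular.
apply/wreg_cons; split.
  move=> f hf; have {hf} : uni_ideal Z ((\prod_(i <- enum (~: Z)) h i) * f).
    rewrite big_enum /=; have := is_idealB hZ hf (is_idealMr f hZ eE).
    by congr (uni_ideal _ _); ring.
  elim: (enum _) creg f => [_ f|i r IHr creg f]; first by rewrite big_nil mul1r.
  rewrite big_cons -mulrA => /(creg i (mem_head _ _)); apply: IHr => j jr.
  by apply: creg; rewrite inE jr orbT.
rewrite (adjoin_congr hZ eE) -big_enum; apply: wreg_adjoin_prod => // i.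
rewrite mem_enum inE => iZ; rewrite hout // -uni_idealU.
have ck : #|~: (i |: Z)| = k.
  by move: cZ; rewrite (cardsD1 i) inE iZ setCU setIC -setDE add1n => -[].
rewrite -ck; apply: IH; last exact: subset_trans Z0Z (subsetUr _ _).
by rewrite ck; move: Zm; rewrite cZ ltnS.
Qed.

End UnivariateIdeal.

(** * Stanley-Reisner ideals *)

Section FaceIdeal.
Variables (K : fieldType) (n : nat).
Local Notation S := {mpoly K[n]}.
Implicit Types (f : S) (I P : S -> Prop) (Q : pred {set 'I_n}).
Implicit Types (u v w : 'X_{1..n}) (A B C F : {set 'I_n}) (i j l : 'I_n).

Definition supp u : {set 'I_n} := [set i | (0 < u i)%N].

Lemma suppD u v : supp (u + v)%MM = supp u :|: supp v.
Proof. by apply/setP => i; rewrite !inE mnmDE addn_gt0. Qed.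

Lemma supp1 i : supp U_(i)%MM = [set i].
Proof. by apply/setP => j; rewrite !inE mnm1E lt0b eq_sym. Qed.

Definition set_mnm A : 'X_{1..n} := [multinom nat_of_bool (i \in A) | i < n].

Lemma supp_set_mnm A : supp (set_mnm A) = A.
Proof. by apply/setP => i; rewrite inE mnmE lt0b. Qed.

Lemma set_mnmX A : 'X_[set_mnm A] = \prod_(i in A) 'X_i :> S.
Proof.
rewrite mpolyXE_id [RHS]big_mkcond /=; apply: eq_bigr => i _.
by rewrite mnmE; case: (i \in A).
Qed.

Definition upclosed Q : Prop := forall A B, A \subset B -> Q A -> Q B.

(* [Q] is the set of nonfaces of a simplicial complex. *)
Definition face_ideal Q : S -> Prop := fun f => forall u, u \in msupp f -> Q (supp u).

Definition facet Q A : Prop := ~~ Q A /\ forall i, i \notin A -> Q (i |: A).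

Definition pure Q (r : nat) : Prop := forall A, facet Q A -> #|A| = r.

Lemma face_sub Q A B : upclosed Q -> A \subset B -> ~~ Q B -> ~~ Q A.
Proof. by move=> hQ AB; apply: contra; exact: hQ. Qed.

Lemma facet_exists Q A : ~~ Q A -> exists2 F, facet Q F & A \subset F.
Proof.
have [m] := ubnP (n - #|A|); elim: m A => // m IH A lt hA.
have [/forallP hF|] := boolP [forall i, (i \notin A) ==> Q (i |: A)].
  by exists A => //; split=> // i; apply/implyP.
rewrite negb_forall => /existsP[i]; rewrite negb_imply => /andP[iA hi].
have [|F hF sF] := IH (i |: A) _ hi.
  have := max_card (mem (i |: A)); rewrite cardsU1 iA card_ord add1n; lia.
by exists F => //; apply: subset_trans sF; exact: subsetUr.
Qed.

Lemma facet_sub Q A B : upclosed Q -> facet Q A -> ~~ Q B -> A \subset B -> A = B.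
Proof.
move=> hQ [_ hA] hB AB; apply/eqP; rewrite eqEsubset AB; apply/subsetP => i iB.
apply: contraR hB => /hA; apply: hQ; apply/subsetP => j; rewrite !inE.
by case/orP => [/eqP->//|]; exact: (subsetP AB).
Qed.

Lemma face_ideal_ideal Q : upclosed Q -> is_ideal (face_ideal Q).
Proof.
move=> hQ; split=> [u|f g hf hg u|a f hf u]; first by rewrite msupp0.
  by move/msuppD_le; rewrite mem_cat => /orP[/hf|/hg].
move=> /msuppM_le/allpairsP[[v w] /= [_ /hf hw ->]].
by rewrite suppD; apply: hQ hw; exact: subsetUr.
Qed.

Lemma face_idealX Q u : face_ideal Q 'X_[u] <-> Q (supp u).
Proof.
rewrite /face_ideal msuppX; split=> [h|h v]; first by apply: h; rewrite inE.
by rewrite inE => /eqP->.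
Qed.

Lemma ideal_mnm I f : is_ideal I -> (forall u, u \in msupp f -> I 'X_[u]) -> I f.
Proof.
move=> hI h; rewrite [f]mpolyE; apply: is_ideal_sum_seq => // u /h hu.
by rewrite -mul_mpolyC; case: hI => _ _; apply.
Qed.

Lemma face_ideal_mulX Q f u :
  face_ideal Q (f * 'X_[u]) <-> face_ideal (fun A => Q (supp u :|: A)) f.
Proof.
split=> h v hv.
  by rewrite -suppD; apply: h; rewrite (perm_mem (msuppMX _ _)); apply: map_f.
by move: hv; rewrite (perm_mem (msuppMX _ _)) => /mapP[w /h + ->]; rewrite suppD.
Qed.

(** The new complex is the star of [i]. *)
Lemma face_ideal_colon Q i :
  (fun f => face_ideal Q ('X_i * f)) = face_ideal (fun A => Q (i |: A)).
Proof.
by apply: pred_eq => f; rewrite mulrC face_ideal_mulX supp1.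
Qed.

(** The new complex is the deletion of [i]. *)
Lemma face_ideal_adjoin Q i : upclosed Q ->
  adjoin (face_ideal Q) 'X_i = face_ideal (fun A => Q A || (i \in A)).
Proof.
move=> hQ; have hI := face_ideal_ideal hQ.
have hQ' : upclosed (fun A => Q A || (i \in A)).
  move=> A B AB /orP[/(hQ _ _ AB)->//|iA].
  by rewrite (subsetP AB _ iA) orbT.
apply: pred_eq => f; split.
  apply: adjoin_min; first exact: face_ideal_ideal.
    by move=> g hg u /hg ->.
  by apply/face_idealX; rewrite supp1 set11 orbT.
move=> h; apply: ideal_mnm; first exact: adjoin_ideal.
move=> u /h /orP[hu|]; first by apply: sub_adjoin; apply/face_idealX.
rewrite inE lt0n -lep1mP => /submK <-; rewrite mpolyXD.
by case: (adjoin_ideal 'X_i hI) => _ _; apply; exact: mem_adjoin.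
Qed.

Lemma face_ideal_simplex Q F : (forall A, Q A = ~~ (A \subset F)) ->
  face_ideal Q = var_ideal F.
Proof.
move=> hQ; have hQu : upclosed Q.
  by move=> A B AB; rewrite !hQ; apply: contra; exact: subset_trans.
have XI i : i \notin F -> face_ideal Q 'X_i.
  by move=> iF; apply/face_idealX; rewrite hQ supp1 sub1set.
apply: pred_eq => f; split=> [h|]; last first.
  by apply: var_ideal_min => //; exact: face_ideal_ideal.
apply: ideal_mnm; first by case: (var_ideal_prime K F).
move=> u /h; rewrite hQ => /subsetPn[i + iF]; rewrite inE lt0n -lep1mP => /submK <-.
rewrite mpolyXD; case: (var_ideal_prime K F) => -[_ _ hM] _ _; apply: hM.
exact/mem_var_ideal.
Qed.

Lemma face_ideal_sub_var Q F : upclosed Q -> ~~ Q F ->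
  forall f, face_ideal Q f -> var_ideal F f.
Proof.
move=> hQ hF f h.
rewrite -(@face_ideal_simplex (fun A => ~~ (A \subset F))) // => u /h.
by apply: contraL => sF; apply: contraNN hF; exact: hQ.
Qed.

Lemma var_idealE F f : var_ideal F f <-> forall u, u \in msupp f -> ~~ (supp u \subset F).
Proof. by rewrite -(@face_ideal_simplex (fun A => ~~ (A \subset F))). Qed.

(** Adding any vertex to a facet gives a nonface, so the prime of F annihilates the monomial of F:
    facet primes are associated primes. *)
Lemma facet_colon Q F f : upclosed Q -> facet Q F ->
  var_ideal F f <-> face_ideal Q (f * 'X_[set_mnm F]).
Proof.
move=> hQ hF; rewrite face_ideal_mulX var_idealE supp_set_mnm.
split=> h u /h; last first.
  by apply: contraL => /setUidPl->; case: hF.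
move=> /subsetPn[i iu iF]; apply: hQ (proj2 hF i iF).
by rewrite subUset sub1set inE iu orbT subsetUl.
Qed.

(** The product of the variables outside P is not in P, so these variables form a face. A facet
    containing it misses only variables of P. *)
Lemma prime_over_face_ideal Q P : upclosed Q -> is_prime P ->
  (forall f, face_ideal Q f -> P f) ->
  exists2 F, facet Q F & forall f, var_ideal F f -> P f.
Proof.
move=> hQ hP JP; pose A := [set i | ~~ `[< P 'X_i >]].
have /facet_exists[F hF AF] : ~~ Q A.
  apply/negP => QA; have : P 'X_[set_mnm A].
    by apply: JP; apply/face_idealX; rewrite supp_set_mnm.
  rewrite set_mnmX => /(is_prime_prod hP)[i]; rewrite inE => /negP h Pi.
  by apply/h/asboolP.
exists F => // f; apply: var_ideal_min; first exact: is_prime_ideal.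
move=> i iF; have : i \notin A by apply: contra iF; exact: (subsetP AF).
by rewrite inE negbK => /asboolP.
Qed.

(** The vertices of F are removed one by one, which climbs from the prime of F to the ideal of the
    origin. *)
Lemma pchain_var F : exists2 P : nat -> S -> Prop, pchain #|F| P &
  P 0%N = var_ideal F /\
  forall k f, (var_ideal F f -> P k f) /\ (P k f -> var_ideal set0 f).
Proof.
have [m] := ubnP #|F|; elim: m F => // m IH F; rewrite ltnS => Fm.
have [->|[x xF]] := set_0Vmem F.
  rewrite cards0; exists (fun=> var_ideal set0) => //.
  by split=> // i; exact: var_ideal_prime.
have cF : #|F| = #|F :\ x|.+1 by rewrite (cardsD1 x) xF.
have [|P [hP hk] [P0 Ps]] := IH (F :\ x); first by rewrite -cF.
have sub f : var_ideal F f -> var_ideal (F :\ x) f.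
  apply: var_ideal_min => [|i iF]; first by case: (var_ideal_prime K (F :\ x)).
  by apply/mem_var_ideal; rewrite inE (negPf iF) andbF.
exists (fun k => if k is k'.+1 then P k' else var_ideal F); last first.
  split=> // -[|k] f; last by have [h1 h2] := Ps k f; split=> [/sub|].
  split=> // /sub; rewrite -P0; exact: (Ps 0%N f).2.
split=> [[|i]|[_|i]]; rewrite ?cF //; first exact: var_ideal_prime.
  rewrite P0; split=> //; exists 'X_x; first by apply/mem_var_ideal; rewrite !inE eqxx.
  by move=> /mem_var_ideal; rewrite xF.
by rewrite ltnS; exact: hk.
Qed.

(** * Pure shifted complexes *)

(** Only vertices from [k] on are exchanged: the star and the deletion of vertex [k] are then
    shifted from [k.+1], which drives the induction. *)
Definition shifted_from k Q : Prop := forall A i l,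
  ~~ Q A -> (k <= i)%N -> (i < l)%N -> i \in A -> l \notin A -> ~~ Q (l |: A :\ i).

Definition cone Q i : Prop := forall A, Q (i |: A) = Q A.

Lemma conesU Q A B : (forall i, i \in B -> cone Q i) -> Q (B :|: A) = Q A.
Proof.
have [m] := ubnP #|B|; elim: m B => // m IH B; rewrite ltnS => Bm hB.
have [->|[x xB]] := set_0Vmem B; first by rewrite set0U.
rewrite -(setD1K xB) -setUA (hB x xB); apply: IH => [|i].
  by move: Bm; rewrite (cardsD1 x) xB.
by rewrite inE => /andP[_]; exact: hB.
Qed.

Variable p : 'I_n -> {poly K}.
Hypothesis mp : forall i, p i \is monic.
Let h i : S := univ ('X * p i) i.

Lemma wreg_simplex F : wreg (var_ideal F) (elem_syms h #|F|).
Proof.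
(* With this choice the prime of F is a [uni_ideal]. On F the value of [g i] at X_i is h_i; outside
   F it is X_i, of which h_i is a multiple. *)
pose g i := if i \in F then 'X * p i else 'X.
have mg i : g i \is monic by rewrite /g; case: ifP => _; rewrite ?monicMl ?monicX.
have -> : var_ideal F = uni_ideal g (~: F).
  have hE := uni_ideal_ideal g (~: F); apply: pred_eq => f; split.
    apply: var_ideal_min => // i iF.
    have := mem_uni_ideal g (Z := ~: F) (i := i); rewrite inE /g (negPf iF) univX; exact.
  apply: ideal_gen_min; first by case: (var_ideal_prime K F).
  move=> _ [i + ->]; rewrite inE /g => iF; rewrite (negPf iF) univX.
  exact/mem_var_ideal.
rewrite -{2}(setCK F); apply: (wreg_elem_syms mg (Z0 := ~: F)) => // i.
  have := mem_uni_ideal g (set11 i); rewrite /g /h; case: ifP => // _.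
  by rewrite univM => H; apply: is_idealMr => //; exact: uni_ideal_ideal.
by rewrite inE negbK /h /g => ->.
Qed.

(* Vertex decomposition: the link and the deletion of the first vertex that is
   neither a cone point nor a nonvertex are again pure. *)
Lemma wreg_pure_shifted k Q r : upclosed Q -> ~~ Q set0 -> pure Q r ->
  shifted_from k Q -> (forall i : 'I_n, (i < k)%N -> cone Q i \/ Q [set i]) ->
  wreg (face_ideal Q) (elem_syms h r).
Proof.
have [m] := ubnP (n - k); elim: m k Q => // m IH k Q; rewrite ltnS => km hQ Q0 pQ sQ hk.
pose V := [set i | ~~ Q [set i]].
have [QV|QV] := boolP (Q V); last first.
  have sV A : Q A = ~~ (A \subset V).
    apply/idP/idP => [QA|/subsetPn[i iA]].
      by apply: contra QV => AV; exact: hQ QA.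
    by rewrite inE negbK; apply: hQ; rewrite sub1set.
  rewrite (face_ideal_simplex sV) -(pQ V); first exact: wreg_simplex.
  by split=> // i; rewrite inE negbK; apply: hQ; exact: subsetUl.
(* If A were a face, all these cone points could be added to it, and V would be a face. *)
have VE A : (forall i, i \in V -> i \notin A -> cone Q i) -> Q A.
  move=> hA; apply: contraLR QV => QA; have: ~~ Q ((V :\: A) :|: A).
    by rewrite conesU // => i; rewrite inE => /andP[iA iV]; exact: hA.
  by apply: face_sub => //; apply/subsetP => i iV; rewrite in_setU in_setD iV andbT orNb.
have kn : (k < n)%N.
  rewrite ltnNge; apply: contra Q0 => nk; apply: VE => i; rewrite inE => iV _.
  by case: (hk i (leq_trans (ltn_ord i) nk)) => // h1; rewrite h1 in iV.
pose j := Ordinal kn.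
have sQ1 Q' : shifted_from k Q' -> shifted_from k.+1 Q'.
  by move=> hs A i l hA /ltnW; exact: hs.
have lt1 (i : 'I_n) : (i < k.+1)%N -> i = j \/ (i < k)%N.
  by rewrite ltnS leq_eqVlt => /orP[/eqP e|]; [left; exact: val_inj | right].
have [cj|cj] := pselect (cone Q j).
  apply: (IH k.+1) => //; [lia | exact: sQ1 |].
  by move=> i /lt1[->|/hk]; [left|].
have [Qj|Qj] := boolP (Q [set j]).
  apply: (IH k.+1) => //; [lia | exact: sQ1 |].
  by move=> i /lt1[->|/hk]; [right|].
apply: (wreg_colon (x := 'X_j)); first exact: face_ideal_ideal.
  rewrite face_ideal_colon; apply: (IH k.+1) => /=; first lia.
  - by move=> A B AB; apply: hQ; exact: setUS.
  - by rewrite setU0.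
  - move=> A [hA mA]; have jA : j \in A.
      by apply: contraT => jA; have := mA j jA; rewrite setUA setUid (negPf hA).
    apply: pQ; split=> [|i iA]; first by rewrite (setUidPr _) ?sub1set in hA.
    have := mA i iA; rewrite setUCA (setUidPr (_ : [set j] \subset A)) ?sub1set //.
  - move=> A i l hA ki il iA lA.
    have ij : i != j by rewrite -val_eqE /= gtn_eqF.
    have lj : l != j by rewrite -val_eqE /= gtn_eqF // (ltn_trans ki).
    have := sQ _ i l hA (ltnW ki) il; rewrite !inE (negPf lj) iA lA orbT => /(_ isT isT).
    congr (~~ Q _); apply/setP => x; rewrite !inE.
    by have [->|//] := eqVneq x j; rewrite /= [j == i]eq_sym (negPf ij) orbT.
  - move=> i /lt1[->|/hk[ci|Qi]].
    + by left=> A; rewrite setUA setUid.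
    + by left=> A; rewrite setUCA ci.
    + by right; apply: hQ Qi; rewrite subsetUr.
rewrite face_ideal_adjoin //; apply: (IH k.+1) => /=; first lia.
- move=> A B AB /orP[/(hQ _ _ AB)->//|jA].
  by rewrite (subsetP AB _ jA) orbT.
- by rewrite (negPf Q0) inE.
- move=> A []; rewrite negb_or => /andP[hA jA] mA; apply: pQ; split=> // i iA.
  have [ij|ij] := eqVneq i j; last first.
    by have := mA i iA; rewrite !inE eq_sym (negPf ij) (negPf jA) !orbF.
  (* Suppose j |: A is a face. For a vertex l after j outside A, the exchange of j for l would make
     l |: A a face, against the maximality of A; a vertex before j is a cone point. So [VE] applies
     and gives a contradiction. *)
  rewrite ij; apply: contraT => hH; have : Q (j |: A).
    apply: VE => l lV; rewrite !inE negb_or => /andP[lj lA].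
    have [lk|kl] := ltnP l k.
      by case: (hk l lk) => // Ql; move: lV; rewrite inE Ql.
    have jl : (j < l)%N by rewrite ltn_neqAle -val_eqE /= eq_sym in lj *; rewrite lj.
    have := sQ _ j l hH (leqnn _) jl; rewrite !inE eqxx (negPf lj) lA => /(_ isT isT).
    rewrite setU1K //; have := mA l lA.
    by rewrite !inE eq_sym (negPf lj) (negPf jA) !orbF => ->.
  by rewrite (negPf hH).
- move=> A i l; rewrite !negb_or => /andP[hA jA] ki il iA lA.
  have lj : l != j by rewrite -val_eqE /= gtn_eqF // (ltn_trans ki).
  by rewrite (sQ _ i l) // 1?ltnW // !inE eq_sym (negPf lj) (negPf jA) andbF.
- move=> i /lt1[->|ik]; first by right; rewrite set11 orbT.
  have ij : j != i by rewrite -val_eqE /= gtn_eqF.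
  case: (hk i ik) => [ci|Qi]; [left=> A | by right; rewrite Qi].
  by rewrite ci !inE (negPf ij).
Qed.

End FaceIdeal.

(** * Purity *)

Section LocalizedQuotient.
Variables (R : comNzRingType) (J : R -> Prop) (M : idealr R).
Hypothesis hM : forall f, f \in M <-> J f.
Variable p : prime_idealr {ideal_quot M}.
Let pi : {rmorphism R -> {ideal_quot M}} := (\pi_{ideal_quot M})%qT.

Lemma quot_locquo : locquo (fun f => f = 1) J pi.
Proof. by have := ideal_quot_locquo M; rewrite (pred_eq hM). Qed.

Lemma quot_loc_locquo : locquo (fun f => ~ pi f \in p) J (@to_loc _ p \o pi).
Proof.
have := locquo_comp quot_locquo (localization_locquo p).
congr (locquo _ _ _); apply: pred_eq => f.
by split=> /negP.
Qed.

Lemma comap_quot_prime : is_prime (fun f => pi f \in p).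
Proof. exact: (comap_prime pi (prime_idealr_is_prime p)). Qed.

Lemma comap_quot_sub f : J f -> pi f \in p.
Proof.
move=> Jf; exact: (comap_sub quot_locquo (idealr_is_ideal p) Jf).
Qed.

Lemma comap_quot_maximal : maximal_ideal p ->
  forall f, ~ pi f \in p -> exists g, pi (f * g - 1) \in p.
Proof.
move=> hp f pf; have hI := idealr_is_ideal p.
have hA := adjoin_ideal (pi f) hI.
have [[c hc]|h1] := pselect (adjoin (fun y => y \in p) (pi f) 1).
  have [x [s [-> e]]] := locquo_surj quot_locquo c.
  exists x; rewrite -opprB rmorphN; apply: (is_idealN hI).
  by rewrite rmorphB rmorph1 rmorphM -e rmorph1 mulr1 mulrC.
have [N hN] := is_ideal_idealr hA h1; case: pf; apply: (hp N).
  by move=> y yp; apply/hN; exact: sub_adjoin.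
by apply/hN; exact: mem_adjoin.
Qed.

End LocalizedQuotient.

Section PureCohenMacaulay.
Variables (K : fieldType) (n : nat) (Q : pred {set 'I_n}).
Local Notation S := {mpoly K[n]}.
Local Notation J := (@face_ideal K n Q).
Hypotheses (hQ : upclosed Q) (Q0 : ~~ Q set0).

Let hJ : is_ideal J. Proof. exact: face_ideal_ideal. Qed.

Lemma face_ideal_proper : ~ J 1.
Proof.
move=> h; have := face_ideal_sub_var hQ Q0 h.
by case: (var_ideal_prime K (set0 : {set 'I_n})).
Qed.

Lemma pure_cohen_macaulay r : shifted_from 0 Q -> pure Q r -> cohen_macaulay_ideal J.
Proof.
move=> sQ pQ; have [M hM] := is_ideal_idealr hJ face_ideal_proper; exists M => //.
have hS := @noetherian_mpoly K n.
split=> [|p hp]; first exact: locquo_noetherian (quot_locquo hM) hS.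
pose q (f : S) := ((\pi_{ideal_quot M})%qT f : {ideal_quot M}) \in p.
have hq : is_prime q := comap_quot_prime p.
have Jq f : J f -> q f := @comap_quot_sub _ _ _ hM p f.
have /choice[g hg] : forall i : 'I_n, exists g : {poly K},
    g \is monic /\ q (map_poly (@mpolyC n K) g).['X_i].
  move=> i; have [g] := zariski hq (comap_quot_maximal hM hp) i.
  by exists g.
apply: (locquo_cohen_macaulay (quot_loc_locquo hM p) hq Jq
  (s := elem_syms (fun i => univ ('X * g i) i) r) hS).
- by apply: (@wreg_pure_shifted K n g _ 0%N Q r) => // i; case: (hg i).
- move=> a; have := mem_elem_syms (is_prime_ideal hq); apply=> i.
  rewrite univM; case: hq => -[_ _ hq] _ _; apply: hq.
  by case: (hg i).
- move=> k P [hP hk] JP; rewrite size_elem_syms.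
  have [F /pQ <- FP] := prime_over_face_ideal hQ (hP 0%N) JP.
  exact: (pchain_bound (conj hP hk) FP).
Qed.

Lemma cohen_macaulay_pure : cohen_macaulay_ideal J -> exists r, pure Q r.
Proof.
move=> [M hM [_ hCM]]; have hS := @noetherian_mpoly K n.
have lM := quot_locquo hM.
set pi : {rmorphism S -> {ideal_quot M}} := (\pi_{ideal_quot M})%qT in lM.
have h0 := var_ideal_prime K (set0 : {set 'I_n}).
have J0 := @face_ideal_sub_var K n Q set0 hQ Q0.
have T0 (f : S) : f = 1 -> ~ var_ideal set0 f by move=> ->; case: h0.
(* This is the ideal of the origin. It is maximal because each polynomial differs from its constant
   term by an element of it. *)
have [p hp] := is_prime_idealr (ext_prime lM h0 J0 T0).
have pE f : pi f \in p <-> var_ideal set0 f.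
  by rewrite hp; exact: (ext_primeE lM).
have pmax : maximal_ideal p.
  move=> N pN y yN; have [f [s [es e]]] := locquo_surj lM y.
  have ye : y = pi f by rewrite -e es rmorph1 mulr1.
  rewrite ye; apply/pE; rewrite /var_ideal (restr0E f).
  set c := _@_0; have [->|c0] := eqVneq c 0; first by rewrite mpolyC0.
  have cN : pi c%:MP \in N.
    have -> : c%:MP = f - (f - restr set0 f) by rewrite [in RHS](restr0E f) opprB addrC subrK.
    rewrite rmorphB rpredB // -?ye //; apply: pN; apply/pE.
    by rewrite /var_ideal rmorphB /= restr_restr setIid subrr.
  have := idealMr (pi (c^-1)%:MP) cN.
  by rewrite -rmorphM -mpolyCM mulVf // mpolyC1 rmorph1 idealr1.
have lq := quot_loc_locquo hM p.
have [k [hle hge]] := cohen_macaulay_localP lq (comap_quot_prime p)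
  (fun f => @comap_quot_sub _ _ _ hM p f) hS (hCM p pmax).
exists k => F hF; apply/eqP; rewrite eqn_leq; apply/andP; split; last first.
  have [||C hC C0] := hge (var_ideal F) 'X_[set_mnm F] (var_ideal_prime K F).
    - move=> f; rewrite -/pi pE; apply: var_ideal_min; first exact: is_prime_ideal.
      by move=> i _; apply/mem_var_ideal; rewrite inE.
    - by move=> f; exact: facet_colon.
  by apply: (pchain_bound hC); rewrite C0.
have [P hP [P0 Ps]] := pchain_var K F.
apply: (hle _ _ hP) => i f; first by move=> /(face_ideal_sub_var hQ hF.1); exact: (Ps i f).1.
by move/(Ps i f).2/pE.
Qed.

Variable I : S -> Prop.
Hypothesis rI : forall f, radical I f <-> J f.

Let sub_radical f : I f -> J f.
Proof. by move=> If; apply/rI; exists 1. Qed.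

Lemma prime_over_radical (P : S -> Prop) : is_prime P -> (forall f, I f -> P f) ->
  forall f, J f -> P f.
Proof. by move=> hP IP f /rI[k /IP]; exact: is_primeX. Qed.

Lemma minimal_prime_facet (p : prime_idealr S) : minimal_prime I p ->
  exists2 F, facet Q F & forall f, f \in p <-> var_ideal F f.
Proof.
move=> [Ip pmin]; have hp := prime_idealr_is_prime p.
have [F hF Fp] := prime_over_face_ideal hQ hp (prime_over_radical hp Ip).
exists F => // f; split=> [fp|]; last exact: Fp.
have [q hq] := is_prime_idealr (var_ideal_prime K F).
apply/hq; move: f fp; apply: pmin => f; last by move/hq/Fp.
by move=> /sub_radical/(face_ideal_sub_var hQ hF.1) h; apply/hq.
Qed.

Lemma facet_minimal_prime F : facet Q F -> exists2 p : prime_idealr S,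
  minimal_prime I p & forall f, f \in p <-> var_ideal F f.
Proof.
move=> hF; have [p hp] := is_prime_idealr (var_ideal_prime K F).
exists p => //; split=> [f /sub_radical/(face_ideal_sub_var hQ hF.1) h|q Iq qp].
  exact/hp.
have hq := prime_idealr_is_prime q.
have [F' hF' Fq] := prime_over_face_ideal hQ hq (prime_over_radical hq Iq).
have FF' : F \subset F'.
  apply/subsetP => i; apply: contraTT => /mem_var_ideal/Fq/qp/hp.
  by move/mem_var_ideal.
move=> f /hp; rewrite (facet_sub hQ hF hF'.1 FF'); exact: Fq.
Qed.

Lemma krull_dim_var_ideal F (M : idealr S) : (forall f, f \in M <-> var_ideal F f) ->
  krull_dim {ideal_quot M} #|F|.
Proof.
move=> hM; have lM := quot_locquo hM; split.
  have [P hP [P0 Ps]] := pchain_var K F.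
  have [|p hp _] := pchain_prime_chain (ext_pchain lM hP (fun i f => (Ps i f).1) _).
    by move=> i f -> /(Ps i 1).2; case: (var_ideal_prime K (set0 : {set 'I_n})).
  by exists p.
move=> l P /prime_chain_pchain hP.
apply: (pchain_bound (comap_pchain lM hP)) => f Ff.
exact: (comap_sub lM (idealr_is_ideal (P 0%N)) Ff).
Qed.

Lemma krull_dim_uniq (R : comNzRingType) k l : krull_dim R k -> krull_dim R l -> k = l.
Proof.
move=> [[P hP] hk] [[P' hP'] hl].
by apply/eqP; rewrite eqn_leq (hl _ _ hP) (hk _ _ hP').
Qed.

Lemma equidimensional_pure : equidimensional I <-> exists r, pure Q r.
Proof.
split=> -[r hr]; exists r.
  move=> F hF; have [p hp pE] := facet_minimal_prime hF.
  exact: krull_dim_uniq (krull_dim_var_ideal pE) (hr p hp).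
move=> p /minimal_prime_facet[F hF hp].
rewrite -(hr F hF); exact: krull_dim_var_ideal.
Qed.

End PureCohenMacaulay.

(** * Combinatorics of shifted complexes *)

Section ShiftedComplex.
Variables (n : nat) (Q : pred {set 'I_n}).
Implicit Types (A B C D F H : {set 'I_n}) (i j l t : 'I_n).

Definition shift_closed (P : pred {set 'I_n}) : Prop := forall A j l,
  P A -> j \in A -> (l < j)%N -> l \notin A -> P (l |: A :\ j).

Definition min_nonface (P : pred {set 'I_n}) A : Prop :=
  P A /\ forall i, i \in A -> ~~ P (A :\ i).

Definition max_index A : nat := \max_(i in A) i.+1.

Definition ord_interval (m b : nat) : {set 'I_n} := [set i : 'I_n | (m - b <= i < m)%N].

Lemma min_nonface_exists (P : pred {set 'I_n}) A : P A ->
  exists2 B, min_nonface P B & B \subset A.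
Proof.
have [m] := ubnP #|A|; elim: m A => // m IH A; rewrite ltnS => Am PA.
have [/forallP hA|] := boolP [forall i, (i \in A) ==> ~~ P (A :\ i)].
  by exists A => //; split=> // i iA; exact: (implyP (hA i)).
rewrite negb_forall => /existsP[i]; rewrite negb_imply negbK => /andP[iA PAi].
have [|B hB BA] := IH (A :\ i) _ PAi; first by move: Am; rewrite (cardsD1 i) iA.
by exists B => //; exact: subset_trans BA (subD1set _ _).
Qed.

Lemma max_index_le A i : i \in A -> (i < max_index A)%N.
Proof. by move=> iA; rewrite /max_index (bigD1 i) //= leq_max leqnn. Qed.

Lemma max_indexP A : A != set0 -> exists2 t, t \in A & max_index A = t.+1.
Proof.
case/set0Pn=> i0 i0A; rewrite /max_index.
by case: (eq_bigmax_cond (fun i : 'I_n => i.+1) (_ : 0 < #|A|)%N) => [|t tA ->];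
  [apply/card_gt0P; exists i0 | exists t].
Qed.

Lemma card_ord_range x y : (y <= n)%N -> #|[set i : 'I_n | (x <= i < y)%N]| = (y - x)%N.
Proof.
move=> yn; rewrite -sum1dep_card.
rewrite -(big_mkord (fun k => x <= k < y)%N (fun=> 1%N)).
have -> : (\sum_(0 <= k < n | x <= k < y) 1 = \sum_(x <= k < y) 1)%N.
  by rewrite (big_nat_widenl x 0) // (big_nat_widen _ y n) //; apply: eq_bigl => i.
by rewrite sum_nat_const_nat muln1.
Qed.

Lemma subset_card A k : (k <= #|A|)%N -> exists2 B : {set 'I_n}, B \subset A & #|B| = k.
Proof.
elim: k => [|k IH] kA; first by exists set0; rewrite ?sub0set ?cards0.
have [B BA cB] := IH (ltnW kA).
have /set0Pn[i] : A :\: B != set0.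
  by rewrite -card_gt0 cardsD (setIidPr BA) cB subn_gt0.
rewrite inE => /andP[iB iA]; exists (i |: B); last by rewrite cardsU1 iB cB.
by rewrite subUset sub1set iA.
Qed.

(** An element of B outside A is exchanged for one of A outside B, until the sets agree; the
    comparison hypothesis passes to each intermediate set. *)
Lemma shift_all (P : pred {set 'I_n}) A B : shift_closed P -> P B -> #|A| = #|B| ->
  (forall l j, l \in A -> l \notin B -> j \in B -> j \notin A -> (l < j)%N) -> P A.
Proof.
move=> hP; have [m] := ubnP #|B :\: A|; elim: m B => // m IH B; rewrite ltnS => Bm PB cAB hlt.
have [BA|[j]] := set_0Vmem (B :\: A).
  have sBA : B \subset A by rewrite -setD_eq0 BA.
  suff -> : A = B by [].
  by apply/esym/eqP; rewrite eqEcard sBA cAB leqnn.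
rewrite inE => /andP[jA jB].
have /set0Pn[l] : A :\: B != set0.
  rewrite setD_eq0; apply: contraNN jA => AB; suff -> : A = B by [].
  by apply/eqP; rewrite eqEcard AB cAB leqnn.
rewrite inE => /andP[lB lA].
have lj := hlt l j lA lB jB jA.
apply: (IH (l |: B :\ j)).
- apply: leq_trans Bm; rewrite [X in (_ < X)%N](cardsD1 j) inE jA jB ltnS.
  apply/subset_leq_card/subsetP => x; rewrite !inE => /andP[xA].
  by case/orP => [/eqP e|/andP[xj xB]]; [rewrite e lA in xA | rewrite xj xA].
- exact: hP.
- by rewrite cAB (cardsD1 j B) jB cardsU1 !inE (negPf lB) andbF.
- move=> x y xA; rewrite !inE negb_or negb_and negbK => /andP[xl xB'] yB' yA.
  have yB : y \in B by case/orP: yB' => [/eqP e|/andP[]//]; rewrite e lA in yA.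
  apply: hlt => //; case/orP: xB' => // /eqP e.
  by rewrite -e xA in jA.
Qed.

Hypotheses (hQ : upclosed Q) (sQ : shift_closed Q) (Q0 : ~~ Q set0).

Lemma shift_closed_shifted : shifted_from 0 Q.
Proof.
move=> A i l QA _ il iA lA; apply: contra QA => Qs.
have li : (l == i) = false by apply/negP => /eqP e; rewrite e ltnn in il.
have := sQ Qs (setU11 _ _) il; rewrite !inE eqxx /= orbF eq_sym li => /(_ isT).
congr (Q _ = true); apply/setP => x; rewrite !inE.
have [->|xl] := eqVneq x l; first by rewrite li (negPf lA).
by rewrite /=; have [->|_] := eqVneq x i; rewrite ?iA.
Qed.

Lemma min_nonface_neq0 A : min_nonface Q A -> A != set0.
Proof. by case=> QA _; apply: contraTneq QA => ->. Qed.

Lemma min_nonface_sub A B : min_nonface Q A -> Q B -> B \subset A -> B = A.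
Proof.
move=> [_ hA] QB BA; apply/eqP; rewrite eqEsubset BA; apply/subsetP => i iA.
apply: contraLR (hA i iA) => iB; rewrite negbK; apply: hQ QB.
by rewrite subsetD1 BA.
Qed.

Variables m b : nat.
Hypothesis hm : forall A, min_nonface Q A -> (max_index A <= m)%N.
Hypothesis hb : forall A, min_nonface Q A -> (#|A| <= b)%N.
Variables Am Ab : {set 'I_n}.
Hypotheses (hAm : min_nonface Q Am) (eAm : max_index Am = m).
Hypotheses (hAb : min_nonface Q Ab) (eAb : #|Ab| = b).

Let m_le : (m <= n)%N.
Proof. by have [t _ e] := max_indexP (min_nonface_neq0 hAm); rewrite -eAm e. Qed.

Let lt_m A i : min_nonface Q A -> i \in A -> (i < m)%N.
Proof. by move=> hA /max_index_le h; exact: leq_trans h (hm hA). Qed.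

Let b_gt0 : (0 < b)%N.
Proof. by rewrite -eAb card_gt0; exact: min_nonface_neq0 hAb. Qed.

Lemma max_card_le : (b <= m)%N.
Proof.
rewrite -eAb -[m]subn0 -(card_ord_range 0 m_le).
by apply/subset_leq_card/subsetP => i /(lt_m hAb) h; rewrite inE.
Qed.

Lemma card_interval : #|ord_interval m b| = b.
Proof. by rewrite card_ord_range // (subKn max_card_le). Qed.

(** An index from m on belongs to no minimal nonface, hence is a cone point. *)
Lemma facet_tail H i : facet Q H -> (m <= i)%N -> i \in H.
Proof.
move=> [QH hH] mi; apply: contraT => iH.
have [D hD Ds] := min_nonface_exists (hH i iH).
have iD : i \in D.
  apply: contraLR QH => iD; rewrite negbK; apply: hQ hD.1; apply/subsetP => x xD.
  move: (subsetP Ds _ xD); rewrite !inE => /orP[/eqP e|//].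
  by rewrite -e xD in iD.
by have := lt_m hD iD; rewrite ltnNge mi.
Qed.

Lemma card_facet H : facet Q H -> #|H| = (#|H :&: [set i : 'I_n | (i < m)%N]| + (n - m))%N.
Proof.
move=> hH; rewrite -(cardsID [set i : 'I_n | (i < m)%N] H); congr (_ + _)%N.
rewrite -(card_ord_range m (leqnn n)); apply: eq_card => i; rewrite !inE ltn_ord andbT -leqNgt.
by apply/andP/idP => [[]//|mi]; rewrite mi (facet_tail hH).
Qed.

Section Pure.
Variable r : nat.
Hypothesis pQ : pure Q r.

(* A facet [H] containing [A] without its last element [t] misses [t] and the
   gaps of [A] below [t], because [Q] is shift closed. *)
Lemma pure_max_index A : min_nonface Q A -> (max_index A + r.+1 <= n + #|A|)%N.
Proof.
move=> hA; have [t tA et] := max_indexP (min_nonface_neq0 hA).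
have tmax i : i \in A -> (i <= t)%N by move=> /max_index_le; rewrite et.
have [H hH sH] := facet_exists (hA.2 t tA).
have tH : t \notin H.
  apply: contraNN hH.1 => tH; apply: hQ hA.1; rewrite -(setD1K tA).
  by rewrite subUset sub1set tH.
pose T := [set i : 'I_n | (t.+1 <= i < n)%N].
have cT : #|T| = (n - t.+1)%N by exact: card_ord_range.
have sub : H \subset (A :\ t) :|: T.
  apply/subsetP => l lH; rewrite in_setU inE; case: (ltnP t l) => [tl|lt].
    by rewrite [X in _ || X]inE tl ltn_ord orbT.
  apply/orP; left; have ltt : l != t by apply: contraNneq tH => <-.
  rewrite inE ltt /=; apply: contraNT hH.1 => lA.
  have := sQ hA.1 tA (_ : (l < t)%N) lA; rewrite ltn_neqAle -val_eqE /= in ltt *.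
  rewrite ltt lt => /(_ isT); apply: hQ.
  by rewrite subUset sub1set lH.
have := leq_trans (subset_leq_card sub) (leq_card_setU _ _); rewrite (pQ hH) cT.
have := cardsD1 t A; rewrite tA; have := ltn_ord t.
by move: #|A| #|A :\ t| => x y; lia.
Qed.

(** A facet containing A without its last element has #|A| - 1 elements below m from A, and all n -
    m indices from m on. *)
Lemma pure_card A : min_nonface Q A -> (#|A| + n <= m + r.+1)%N.
Proof.
move=> hA; have [t tA et] := max_indexP (min_nonface_neq0 hA).
have [H hH sH] := facet_exists (hA.2 t tA).
have : (#|A :\ t| + (n - m) <= #|H|)%N.
  rewrite (card_facet hH) leq_add2r; apply/subset_leq_card/subsetP => i iA.
  rewrite in_setI (subsetP sH _ iA) inE; apply: lt_m hA _.
  by move: iA; rewrite inE => /andP[].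
rewrite (pQ hH); have := cardsD1 t A; rewrite tA; have := m_le; lia.
Qed.

(** The nonface ending at m gives one inequality, the one with b elements the other. So the
    codimension n - r is m - b + 1. *)
Lemma pure_codim : (m + r.+1 = n + b)%N.
Proof.
apply/eqP; rewrite eqn_leq; apply/andP; split.
  by have := pure_max_index hAm; rewrite eAm; have := hb hAm; lia.
by have := pure_card hAb; rewrite eAb addnC.
Qed.

Lemma pure_card_last : #|Am| = b.
Proof.
have := pure_max_index hAm; rewrite eAm; have := hb hAm; have := pure_codim; lia.
Qed.

Lemma pure_gap A : min_nonface Q A -> (max_index A - #|A| <= m - b)%N.
Proof. by move=> /pure_max_index; have := pure_codim; have := max_card_le; lia. Qed.

Lemma pure_interval : min_nonface Q (ord_interval m b).
Proof.
set V := ord_interval m b.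
(* A facet containing the interval would have at least b + (n - m) = r + 1 elements. *)
have QV : Q V.
  apply: contraT => /facet_exists[H hH VH].
  have : (b <= #|H :&: [set i : 'I_n | (i < m)%N]|)%N.
    rewrite -card_interval; apply/subset_leq_card/subsetP => i iV.
    by rewrite in_setI (subsetP VH _ iV) inE; move: iV; rewrite inE => /andP[].
  have := card_facet hH; rewrite (pQ hH); have := pure_codim; have := m_le; lia.
split=> // i iV; have [t tA et] := max_indexP (min_nonface_neq0 hAm).
have mt : m = t.+1 by rewrite -et eAm.
have tV : t \in V by rewrite inE mt leqnn andbT; have := b_gt0; lia.
have iVm : (m - b <= i < m)%N by move: iV; rewrite inE.
(* If V without i were a nonface, shifting would make V without its last element t a nonface, and
   then [Am] without t, since [Am] also has b elements and ends in t. *)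
apply: contraNN (hAm.2 t tA) => QVi.
have QVt : Q (V :\ t).
  have [<-//|it] := eqVneq i t.
  have tVi : t \in V :\ i by rewrite in_setD1 eq_sym it tV.
  have lt_it : (i < t)%N by rewrite ltn_neqAle val_eqE it -ltnS -mt; case/andP: iVm.
  have := sQ QVi tVi lt_it; rewrite setD11 => /(_ isT).
  suff -> : i |: V :\ i :\ t = V :\ t by [].
  apply/setP => x; rewrite in_setU1 !in_setD1.
  by have [->|xi] := eqVneq x i; rewrite /= ?it ?iV.
apply: (shift_all sQ QVt).
  have h1 := cardsD1 t Am; have h2 := cardsD1 t V.
  rewrite tA pure_card_last in h1; rewrite tV card_interval in h2.
  exact: (addnI (etrans (esym h1) h2)).
move=> l j; rewrite !inE => /andP[lt lA] lV /andP[jt jV] _.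
have lm := lt_m hAm lA; move: lV jV; rewrite lt lm andbT /= -ltnNge.
by move=> h /andP[h' _]; exact: leq_trans h h'.
Qed.

End Pure.

(** Every facet has exactly b - 1 elements below m: any b such indices are a shift of the interval,
    hence a nonface, and fewer than b - 1 would violate the gap condition. *)
Lemma interval_pure : Q (ord_interval m b) ->
  (forall A, min_nonface Q A -> (max_index A - #|A| <= m - b)%N) ->
  pure Q (n - (m - b).+1).
Proof.
move=> QV hgap H hH.
set M := [set i : 'I_n | (i < m)%N]; set s := #|H :&: M|.
have cM : #|M| = m by rewrite -[RHS]subn0 -(card_ord_range 0 m_le).
have s_lt : (s < b)%N.
  rewrite ltnNge; apply/negP => /subset_card[A AH cA].
  move/negP: hH.1; apply; apply: hQ (subset_trans AH (subsetIl _ _)) _.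
  apply: (shift_all sQ QV); first by rewrite card_interval.
  move=> l j lA; rewrite !inE => lV /andP[jV _] _.
  have lm : (l < m)%N by move: (subsetP AH _ lA); rewrite !inE => /andP[].
  by move: lV; rewrite lm andbT -ltnNge => /leq_trans; apply.
have s_ge : (b <= s.+1)%N.
  rewrite leqNgt; apply/negP => sb.
  have /set0Pn[t0 t0M] : M :\: H != set0.
    rewrite setD_eq0; apply/negP => MH; move: sb; rewrite /s (setIidPr MH) cM.
    have := max_card_le; lia.
  (* With t the largest index below m missing in H, take a minimal nonface A inside t |: H, with
     last element T. As t is in A, all indices strictly between T and m lie in H, so #|A| + (m - T -
     1) <= s + 1. The gap condition for A turns this into b <= s + 1. *)
  have [t] := arg_maxnP (fun i : 'I_n => nat_of_ord i) t0M.
  move=> tMH tmax; have : t \in M :\: H := tMH.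
  rewrite !inE => /andP[tH tm].
  have [A hA sA] := min_nonface_exists (hH.2 t tH).
  have tA : t \in A.
    apply: contraLR hH.1 => tA; rewrite negbK; apply: hQ hA.1; apply/subsetP => x xA.
    move: (subsetP sA _ xA); rewrite !inE => /orP[/eqP e|//].
    by rewrite -e xA in tA.
  have [T TA eT] := max_indexP (min_nonface_neq0 hA).
  have tT : (t <= T)%N by rewrite -ltnS -eT; exact: max_index_le.
  have Tm := lt_m hA TA.
  have hsub : A :|: [set i : 'I_n | (T.+1 <= i < m)%N] \subset t |: (H :&: M).
    rewrite subUset; apply/andP; split; apply/subsetP => x.
      move=> xA; move: (subsetP sA _ xA); rewrite !inE (lt_m hA xA) andbT; exact.
    rewrite !inE => /andP[Tx xm]; rewrite xm andbT; apply/orP; right.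
    apply: contraT => xH; have xMH : x \in M :\: H by rewrite !inE xH xm.
    by have /= := tmax x xMH; rewrite leqNgt (leq_ltn_trans tT Tx).
  have := subset_leq_card hsub; rewrite cardsU.
  have -> : A :&: [set i : 'I_n | (T.+1 <= i < m)%N] = set0.
    apply/setP => x; rewrite !inE; apply/negP => /and3P[/max_index_le].
    by rewrite eT ltnS leqNgt => /negP.
  rewrite cards0 subn0 card_ord_range // cardsU1.
  have := hgap A hA; rewrite eT -/s; have := max_card_le.
  move: sb Tm (leq_b1 (t \notin H :&: M)); clear; move: s (nat_of_bool _) #|A| (nat_of_ord T) => x c y z; lia.
have := card_facet hH; rewrite -/M -/s; have := max_card_le; have := m_le; lia.
Qed.

End ShiftedComplex.

(** * Monomial ideals *)

Section MonomialIdeal.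
Variables (K : fieldType) (n : nat).
Local Notation S := {mpoly K[n]}.
Implicit Types (f g : S) (J L : S -> Prop) (u v w : 'X_{1..n}).
Implicit Types (A C F : {set 'I_n}) (P Q : pred {set 'I_n}).

Lemma monomial_idealE (U : 'X_{1..n} -> Prop) f :
  monomial_ideal K U f <->
  forall u, u \in msupp f -> exists2 v, U v & (v <= u)%MM.
Proof.
split=> [hf|h]; last first.
  apply: ideal_mnm => [|u /h[v Uv /submK <-]]; first exact: ideal_gen_ideal.
  rewrite mpolyXD; case: (ideal_gen_ideal (fun f => exists2 u, U u & f = 'X_[u])).
  by move=> _ _; apply; apply: sub_ideal_gen; exists v.
pose I f := forall u, u \in msupp f -> exists2 v, U v & (v <= u)%MM.
suff : I f by []; have hI : is_ideal I.
  split=> [u|g1 g2 h1 h2 u|a g hg u]; first by rewrite msupp0.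
    by move/msuppD_le; rewrite mem_cat => /orP[/h1|/h2].
  move=> /msuppM_le/allpairsP[[v w] /= [_ /hg[x Ux xw] ->]]; exists x => //.
  exact: lepm_trans xw (lem_addl _ _).
have := ideal_gen_min hI _ hf; apply=> _ [u Uu ->] v.
by rewrite msuppX inE => /eqP->; exists u => //; exact: lepm_refl.
Qed.

Lemma lepm_antisym u v : (u <= v)%MM -> (v <= u)%MM -> u = v.
Proof.
move=> /mnm_lepP uv /mnm_lepP vu; apply/mnmP => i.
by apply/eqP; rewrite eqn_leq uv vu.
Qed.

Section MinGens.
Variables (J : S -> Prop) (W : 'X_{1..n} -> Prop).
Hypothesis JW : forall f, J f <-> forall u, u \in msupp f -> W u.
Hypothesis Wup : forall u v, (u <= v)%MM -> W u -> W v.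

Let JX u : J 'X_[u] <-> W u.
Proof.
rewrite JW msuppX; split=> [h|Wu v]; first by apply: h; rewrite inE.
by rewrite inE => /eqP->.
Qed.

Let monomial_W (U : 'X_{1..n} -> Prop) : (forall u, U u -> W u) ->
  (forall f, J f <-> monomial_ideal K U f) <->
  (forall u, W u -> exists2 v, U v & (v <= u)%MM).
Proof.
move=> UW; split=> [h u /JX/h/monomial_idealE|h f].
  by rewrite msuppX; apply; rewrite inE.
rewrite JW monomial_idealE; split=> hf u /hf; first exact: h.
by move=> [v /UW Wv vu]; exact: Wup Wv.
Qed.

(** A generator with a proper divisor in W could be omitted. Conversely, by induction on the degree,
    each monomial of W has a divisor minimal in W, and every generating set must contain the minimal
    ones. *)
Lemma mingensE u : mingens J u <-> W u /\ forall v, (v <= u)%MM -> W v -> v = u.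
Proof.
split=> [[U [hU Umin] Uu]|[Wu umin]].
  have UW v : U v -> W v.
    move=> Uv; apply/JX/hU/monomial_idealE => w; rewrite msuppX inE => /eqP->.
    by exists v => //; exact: lepm_refl.
  have gU := (monomial_W UW).1 hU; split=> [|v vu Wv]; first exact: UW.
  have [x Ux xv] := gU v Wv; have xu := lepm_trans xv vu.
  suff e : x = u by apply: lepm_antisym => //; rewrite -e.
  apply: contrapT => ne; have := Umin (fun w => U w /\ w <> u).
  case/(_ _ _ u Uu) => [w []//||_ []//].
  apply/monomial_W => [w [/UW]//|w /gU[y Uy yw]].
  have [e|yu] := pselect (y = u); last by exists y.
  by exists x => //; apply: lepm_trans xu _; rewrite -e.
pose U v := W v /\ forall w, (w <= v)%MM -> W w -> w = v.
have UW v : U v -> W v by case.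
exists U => //; split=> [|V VU hV v [Wv vmin]].
  apply/(monomial_W UW) => w.
  have [k] := ubnP (mdeg w); elim: k w => // k IH w; rewrite ltnS => wk Ww.
  have [hw|] := pselect (forall v, (v <= w)%MM -> W v -> v = w).
    by exists w => //; exact: lepm_refl.
  move=> /existsNP[v /not_implyP[vw /not_implyP[Wv ne]]].
  have [|x Ux xv] := IH v _ Wv; last by exists x => //; exact: lepm_trans xv vw.
  apply: leq_trans wk; rewrite -(submK vw) mdegD -[X in (X < _)%N]add0n ltn_add2r.
  rewrite lt0n mdeg_eq0; apply/eqP => e; apply: ne.
  by rewrite -(submK vw) e add0m.
have VW w : V w -> W w by move=> /VU/UW.
have [x Vx xv] := (monomial_W VW).1 hV v Wv.
by rewrite -(vmin x xv (VW x Vx)).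
Qed.

End MinGens.

Lemma supp_le u v : (u <= v)%MM -> supp u \subset supp v.
Proof.
move=> /mnm_lepP uv; apply/subsetP => i; rewrite !inE => ui.
exact: leq_trans ui (uv i).
Qed.

Lemma set_mnm_le A u : (set_mnm A <= u)%MM = (A \subset supp u).
Proof.
apply/mnm_lepP/subsetP => [h i iA|h i]; first by have := h i; rewrite mnmE iA inE.
by rewrite mnmE; case: (boolP (i \in A)) => // /h; rewrite inE.
Qed.

Lemma mdeg_set_mnm A : mdeg (set_mnm A) = #|A|.
Proof.
rewrite mdegE -sum1_card [RHS]big_mkcond /=; apply: eq_bigr => i _.
by rewrite mnmE; case: (i \in A).
Qed.

Lemma max_var_set_mnm A : max_var (set_mnm A) = max_index A.
Proof. by apply: eq_bigl => i; rewrite mnmE lt0b. Qed.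

Lemma mingens_face_ideal Q u : upclosed Q ->
  mingens (face_ideal (K := K) Q) u <-> exists2 A, min_nonface Q A & u = set_mnm A.
Proof.
move=> hQ; rewrite (@mingensE _ (fun u => Q (supp u))) //; last first.
  by move=> v w /supp_le; exact: hQ.
split=> [[Qu umin]|[A [QA minA] ->]].
  exists (supp u); last first.
    by apply/esym/umin; rewrite ?set_mnm_le ?supp_set_mnm.
  split=> // i iu; apply/negP => Qi.
  have : set_mnm (supp u :\ i) = u.
    by apply: umin; rewrite ?set_mnm_le ?subD1set ?supp_set_mnm.
  by move/(congr1 (@supp n)); rewrite supp_set_mnm => /setP/(_ i); rewrite iu setD11.
rewrite supp_set_mnm; split=> // v vA Qv; apply: lepm_antisym => //.
rewrite set_mnm_le -(min_nonface_sub hQ (conj QA minA) Qv) //.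
by have := supp_le vA; rewrite supp_set_mnm.
Qed.

Lemma face_ideal_squarefree P : upclosed P ->
  squarefree_monomial_ideal (face_ideal (K := K) P).
Proof.
move=> hP; exists (fun u => exists2 A, P A & u = set_mnm A).
  by move=> _ [A _ ->] i; rewrite mnmE leq_b1.
move=> f; rewrite monomial_idealE; split=> h u /h.
  by move=> Pu; exists (set_mnm (supp u)); rewrite ?set_mnm_le //; exists (supp u).
by move=> [_ [A PA ->]]; rewrite set_mnm_le => /hP; apply.
Qed.

Lemma supp_shift A (j l : 'I_n) : j \in A -> l \notin A ->
  supp (set_mnm A + U_(l) - U_(j))%MM = l |: A :\ j.
Proof.
move=> jA lA; apply/setP => i; rewrite !inE mnmBE mnmDE mnmE !mnm1E.
have [->|il] := eqVneq i l.
  by rewrite (negPf lA); case: eqP => [e|]; first by rewrite -e jA in lA.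
rewrite /= addn0.
by have [->|ij] := eqVneq i j; rewrite ?jA ?subn0 ?lt0b.
Qed.

Lemma face_ideal_stable P : upclosed P -> shift_closed P ->
  squarefree_strongly_stable (face_ideal (K := K) P).
Proof.
move=> hP sP; split=> [|u /(mingens_face_ideal _ hP)[A [PA _] ->] j l].
  exact: face_ideal_squarefree.
rewrite !mnmE lt0b => jA lj /eqP; rewrite eqb0 => lA.
by apply/face_idealX; rewrite supp_shift //; exact: sP.
Qed.

Lemma stable_face_ideal L : squarefree_strongly_stable L ->
  exists P, [/\ upclosed P, shift_closed P & L = face_ideal P].
Proof.
move=> [[U U1 LU] sL].
pose P : pred {set 'I_n} := fun A => `[< exists2 v, U v & supp v \subset A >].
have hP : upclosed P.
  move=> A C AC /asboolP[v Uv vA]; apply/asboolP; exists v => //.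
  exact: subset_trans vA AC.
have eL : L = face_ideal P.
  apply: pred_eq => f; rewrite LU monomial_idealE.
  split=> h u /h => [[v Uv vu]|/asboolP[v Uv vu]].
    by apply/asboolP; exists v => //; exact: supp_le.
  exists v => //; apply/mnm_lepP => i; have := U1 v Uv i.
  case vi: (v i) => [//|[|//]] _; move/subsetP: vu => /(_ i).
  by rewrite !inE vi; apply.
exists P; split=> // A j l PA jA lj lA.
(* Stability speaks of minimal generators only, so the exchange is made in a minimal nonface C
   inside A; if j is not in C, then C itself survives the exchange. *)
have [C hC CA] := min_nonface_exists PA.
have [jC|jC] := boolP (j \in C); last first.
  apply: hP hC.1; apply/subsetP => i iC; rewrite !inE (subsetP CA _ iC) andbT.
  by apply/orP; right; apply: contraNneq jC => <-.
have lC : l \notin C by apply: contra lA; exact: (subsetP CA).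
have : L 'X_[set_mnm C + U_(l) - U_(j)].
  apply: sL => //; rewrite ?mnmE ?jC ?(negPf lC) //.
  by rewrite eL; apply/(mingens_face_ideal _ hP); exists C.
rewrite eL => /face_idealX; rewrite supp_shift //; apply: hP.
by apply: setUS; exact: setSD.
Qed.

Lemma radical_ideal J : is_ideal J -> is_ideal (radical J).
Proof.
move=> hJ; case: (hJ) => J0 JD JM; split; first by exists 1; rewrite expr1.
- move=> f g [k hf] [l hg]; exists (k + l)%N; rewrite exprDn.
  apply: is_ideal_sum => // i _; rewrite -mulr_natr; apply: (is_idealMr _ hJ).
  have [ik|ki] := leqP l i.
    by rewrite -(subnK ik) exprD mulrA; exact: JM.
  have -> : (k + l - i = (l - i) + k)%N by lia.
  by rewrite exprD mulrAC; exact: JM.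
- move=> a f [k hf]; exists k; rewrite exprMn; exact: JM.
Qed.

Lemma face_ideal_radical Q k f : upclosed Q ->
  face_ideal Q (f ^+ k) -> face_ideal Q f.
Proof.
move=> hQ hf u uf; apply: contraT => Qu.
have := face_ideal_sub_var hQ Qu hf; move/(is_primeX (var_ideal_prime K (supp u))).
by move/var_idealE => /(_ u uf); rewrite subxx.
Qed.

Lemma sub_mnm_deg w d : (d <= mdeg w)%N -> exists2 v, (v <= w)%MM & mdeg v = d.
Proof.
move=> /subnK; move: (mdeg w - d)%N => k; elim: k w => [|k IH] w e.
  by exists w => //; exact: lepm_refl.
have [i wi] : exists i, (U_(i) <= w)%MM.
  apply: contrapT => h; have : mdeg w = 0%N; last by rewrite -e.
  apply/eqP; rewrite mdeg_eq0; apply/eqP/mnmP => i; rewrite mnm0E; apply/eqP.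
  by apply: contraT => wi; case: h; exists i; rewrite lep1mP.
have [|v vw dv] := IH (w - U_(i))%MM.
  by move: e; rewrite -{1}(submK wi) mdegD mdeg1; lia.
by exists v => //; exact: lepm_trans vw (lem_subr _ _).
Qed.

(** * Ideals of Veronese type *)

Section Veronese.
Variables (d : nat) (a : 'I_n -> nat).
Local Notation I := (veronese_ideal K d a).

Definition threshold : pred {set 'I_n} := fun A => (d <= \sum_(i in A) a i)%N.

Lemma threshold_upclosed : upclosed threshold.
Proof.
move=> A C AC; rewrite /threshold => /leq_trans; apply.
rewrite [X in (_ <= X)%N](big_setID A) /= (setIidPr AC); exact: leq_addr.
Qed.

Lemma threshold_shift_closed : (forall i j : 'I_n, (i <= j)%N -> (a j <= a i)%N) ->
  shift_closed threshold.
Proof.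
move=> ha A j l; rewrite /threshold => /leq_trans + jA lj lA; apply.
rewrite (big_setD1 j) //= big_setU1 ?inE ?(negPf lA) ?andbF //=.
by rewrite leq_add2r; apply: ha; exact: ltnW.
Qed.

Lemma veronese_supp u : mdeg u = d -> (forall i, (u i <= a i)%N) -> threshold (supp u).
Proof.
move=> du ua; rewrite /threshold -du mdegE (bigID (mem (supp u))) /=.
rewrite [X in (_ + X)%N]big1 ?addn0 => [|i]; first exact: leq_sum.
by rewrite inE lt0n negbK => /eqP.
Qed.

Lemma threshold_veronese A : threshold A ->
  exists u, [/\ mdeg u = d, forall i, (u i <= a i)%N & supp u \subset A].
Proof.
move=> hA; pose w : 'X_{1..n} := [multinom (if i \in A then a i else 0%N) | i < n].
have [|v vw dv] := @sub_mnm_deg w d.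
  by rewrite mdegE; under eq_bigr => i _ do rewrite mnmE; rewrite -big_mkcond.
move/mnm_lepP: vw => vw; exists v; split=> // [i|].
  by apply: leq_trans (vw i) _; rewrite mnmE; case: ifP.
apply/subsetP => i; rewrite inE; apply: contraTT => iA.
by have := vw i; rewrite mnmE (negPf iA) leqn0 => /eqP->.
Qed.

(** The given generators all have degree d, so none properly divides another. *)
Lemma mingens_veronese u : mingens I u <-> mdeg u = d /\ forall i, (u i <= a i)%N.
Proof.
pose W u := exists2 v, (mdeg v = d /\ forall i, (v i <= a i)%N) & (v <= u)%MM.
rewrite (@mingensE I W); first split=> [[[v hv vu] umin]|[du ua]].
- have /umin e := vu; rewrite -e //; exists v => //; exact: lepm_refl.
- split=> [|v vu [w [dw wa] wv]]; first by exists u => //; exact: lepm_refl.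
  have wu := lepm_trans wv vu.
  have e : w = u.
    apply/esym; rewrite -(submK wu).
    have : mdeg (u - w)%MM = 0%N by move: (submK wu) => /(congr1 mdeg); rewrite mdegD; lia.
    by move/eqP; rewrite mdeg_eq0 => /eqP->; rewrite add0m.
  by apply: lepm_antisym => //; rewrite -e.
- by move=> f; exact: monomial_idealE.
- by move=> v w vw [x hx xv]; exists x => //; exact: lepm_trans xv vw.
Qed.

Lemma vertex_cover_veronese (W : {set 'I_n}) : vertex_cover I W <-> ~~ threshold (~: W).
Proof.
split=> [hW|hW u /mingens_veronese[du ua]].
  apply/negP => /threshold_veronese[u [du ua uW]].
  have [|i iW ui] := hW u; first exact/mingens_veronese.
  by have := subsetP uW i; rewrite !inE iW => /(_ ui).
apply: contrapT => h; move/negP: hW; apply.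
apply: threshold_upclosed (veronese_supp du ua); apply/subsetP => i; rewrite !inE => ui.
by apply/negP => iW; apply: h; exists i.
Qed.

Lemma minimal_vertex_cover_facet (W : {set 'I_n}) :
  minimal_vertex_cover I W -> facet threshold (~: W).
Proof.
move=> [/vertex_cover_veronese hW Wmin]; split=> // i; rewrite inE negbK => iW.
have -> : i |: ~: W = ~: (W :\ i) by rewrite setCD setUC.
apply: contraT => h; case: (Wmin (W :\ i)); first exact: properD1.
exact/vertex_cover_veronese.
Qed.

Hypothesis had : forall i : 'I_n, (a i <= d)%N.

Lemma radical_veronese f : radical I f <-> face_ideal threshold f.
Proof.
have hQ := threshold_upclosed; split=> [[k /monomial_idealE hf]|hf].
  apply: (face_ideal_radical (k := k)) => // u /hf[v [dv va] /supp_le].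
  by move=> vu; exact: hQ vu (veronese_supp dv va).
apply: ideal_mnm => [|u /hf]; first exact/radical_ideal/ideal_gen_ideal.
move=> /threshold_veronese[v [dv va vu]].
(* In the d-th power each exponent on the support is at least d, hence at least a_i and v_i. *)
exists d; rewrite mpolyXn; apply/monomial_idealE => w; rewrite msuppX inE => /eqP->.
exists v => //; apply/mnm_lepP => i; rewrite mulmnE.
have [->//|vi] := posnP (v i); have : i \in supp v by rewrite inE.
move=> /(subsetP vu); rewrite inE => ui.
apply: leq_trans (va i) (leq_trans (had i) _).
by rewrite leq_pmull.
Qed.

End Veronese.

(** * Borel generators *)

Section Borel.
Variables (Q : pred {set 'I_n}) (m b : nat).
Hypotheses (hQ : upclosed Q) (sQ : shift_closed Q).
Local Notation J := (face_ideal (K := K) Q).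
Local Notation V := (ord_interval n m b).
Hypothesis hV : min_nonface Q V.
Hypothesis cV : #|V| = b.
Hypothesis lt_m : forall A i, min_nonface Q A -> i \in A -> (i < m)%N.
Hypothesis hb : forall A, min_nonface Q A -> (#|A| <= b)%N.
Implicit Types (B : 'X_{1..n} -> Prop).

(** Squarefree strongly stable ideals are the face ideals of upward and shift closed families, so
    being smallest can be tested on families of sets. *)
Lemma smallest_stableE B : smallest_squarefree_strongly_stable B J <->
  (forall u, B u -> Q (supp u)) /\
  forall P, upclosed P -> shift_closed P -> (forall u, B u -> P (supp u)) ->
    forall A, Q A -> P A.
Proof.
split=> [[sJ BJ Jmin]|[BQ Bmin]].
  split=> [u /BJ/face_idealX //|P hP sP BP A QA].
  rewrite -(supp_set_mnm A); apply/(face_idealX K).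
  apply: Jmin; first exact: face_ideal_stable.
    by move=> u /BP h; apply/face_idealX.
  by apply/face_idealX; rewrite supp_set_mnm.
split=> [|u /BQ h|L /stable_face_ideal[P [hP sP ->]] BP f hf u /hf].
- exact: face_ideal_stable.
- exact/face_idealX.
- by apply: Bmin => // v /BP/face_idealX.
Qed.

(* The minimal nonfaces other than [V] generate a strongly stable ideal that
   does not contain [V]. *)
Lemma interval_in_borel B : (forall u, B u -> mingens J u) ->
  smallest_squarefree_strongly_stable B J -> B (set_mnm V).
Proof.
move=> BG /smallest_stableE[_ Bmin]; apply: contrapT => BV.
pose P A := `[< exists C, [/\ min_nonface Q C, C <> V & C \subset A] >].
have hP : upclosed P.
  move=> A A' AA' /asboolP[C [hC CV CA]]; apply/asboolP; exists C; split=> //.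
  exact: subset_trans CA AA'.
have sP : shift_closed P.
  move=> A j l /asboolP[C [hC CV CA]] jA lj lA.
  have [jC|jC] := boolP (j \in C); last first.
    apply/asboolP; exists C; split=> //; apply/subsetP => i iC.
    rewrite !inE (subsetP CA _ iC) andbT.
    by apply/orP; right; apply: contraNneq jC => <-.
  have lC : l \notin C by apply: contra lA; exact: (subsetP CA).
  have [D hD DC] := min_nonface_exists (sQ hC.1 jC lj lC).
  apply/asboolP; exists D; split=> //; last first.
    by apply: subset_trans DC _; apply: setUS; exact: setSD.
  (* Comparing sizes forces equality. But then l is in the interval V and l < j < m, so j is in V as
     well, although it was removed. *)
  move=> eD; have : V = l |: C :\ j.
    apply/eqP; rewrite eqEcard -{1}eD DC cV cardsU1 !inE (negPf lC) andbF /=.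
    by have := cardsD1 j C; rewrite jC => <-; exact: hb.
  move=> /setP e; have := e l; have := e j.
  rewrite !inE !eqxx /= orbF => e1 /andP[h1 _].
  have jl : (j == l) = false by apply/negP => /eqP e2; rewrite e2 ltnn in lj.
  by move: e1; rewrite jl (leq_trans h1 (ltnW lj)) (lt_m hC jC).
have [|C [hC CV CsV]] := asboolW (Bmin P hP sP _ V hV.1).
  move=> u Bu; have /(mingens_face_ideal _ hQ)[A hA eA] := BG u Bu.
  apply/asboolP; exists A; rewrite eA supp_set_mnm; split=> // e.
  by apply: BV; rewrite -e -eA.
by apply: CV; exact: (min_nonface_sub hQ hV hC.1).
Qed.

(** Among the finitely many generating families of minimal nonfaces, one of least cardinality is
    minimal for inclusion. *)
Lemma minimal_borel_set_exists : exists B, minimal_borel_set J B.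
Proof.
pose of_fam (F : {set {set 'I_n}}) u := exists2 A, A \in F & u = set_mnm A.
pose ok (F : {set {set 'I_n}}) := `[< (forall u, of_fam F u -> mingens J u) /\
  smallest_squarefree_strongly_stable (of_fam F) J >].
have okT : ok [set A | `[< min_nonface Q A >]].
  apply/asboolP; split=> [u [A] |].
    by rewrite inE => /asboolP hA ->; apply/mingens_face_ideal => //; exists A.
  apply/smallest_stableE; split=> [u [A]|P hP _ h A].
    by rewrite inE => /asboolP[QA _] ->; rewrite supp_set_mnm.
  move=> /min_nonface_exists[C hC CA]; apply: (hP C) CA _; rewrite -(supp_set_mnm C).
  by apply: h; exists C => //; rewrite inE; apply/asboolP.
case: (arg_minnP (P := ok) (fun F : {set {set 'I_n}} => #|F|) okT) => F /asboolP[FG FJ] Fmin.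
exists (of_fam F); split=> // B BF BJ u Fu.
pose F' := [set A in F | `[< B (set_mnm A) >]].
have eB : B = of_fam F'.
  apply: pred_eq => v; split=> [Bv|[A]].
    by have [A AF e] := BF v Bv; exists A => //; rewrite inE AF; apply/asboolP; rewrite -e.
  by rewrite inE => /andP[_ /asboolP + ->].
have /Fmin le : ok F'.
  by apply/asboolP; rewrite -eB; split=> // v /BF/FG.
have eF : F' = F.
  by apply/eqP; rewrite eqEcard le andbT; apply/subsetP => A; rewrite inE => /andP[].
by rewrite eB eF.
Qed.

(** All minimal nonfaces lie below m, so one with b elements is a shift of V. As V is itself a Borel
    generator, any other of that degree could be dropped. *)
Lemma borel_interval u : (borel_generators J u /\ mdeg u = b) <-> u = set_mnm V.
Proof.
split=> [[[B [BG BJ Bmin] Bu] du]|->]; last first.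
  split; last by rewrite mdeg_set_mnm.
  have [B hB] := minimal_borel_set_exists; exists B => //.
  by case: hB => BG BJ _; exact: interval_in_borel.
apply: contrapT => ne; have BV := interval_in_borel BG BJ.
have [|//|//] := Bmin (fun v => B v /\ v <> u) _ _ u Bu; first by move=> v [].
have /smallest_stableE[BQ Bgen] := BJ.
apply/smallest_stableE; split=> [v [/BQ]//|P hP sP BP]; apply: Bgen => // v Bv.
have [e|] := pselect (v = u); last by move=> vu; apply: BP.
have PV : P V by rewrite -(supp_set_mnm V); apply: BP; split=> // e'; apply: ne.
have /(mingens_face_ideal _ hQ)[A hA eA] := BG u Bu.
rewrite e eA supp_set_mnm; apply: (shift_all sP PV).
  by rewrite cV -du eA mdeg_set_mnm.
move=> l j lA; rewrite !inE => lV /andP[jV _] _.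
by move: lV; rewrite (lt_m hA lA) andbT -ltnNge => /leq_trans; apply.
Qed.

End Borel.

End MonomialIdeal.

Theorem theorem2p6 (K : fieldType) (n d : nat) (a : 'I_n -> nat)
  (hd : (1 <= d)%N)
  (had : forall i : 'I_n, (a i <= d)%N)
  (ha : forall i j : 'I_n, (i <= j)%N -> (a j <= a i)%N)
  (hsum : (d <= \sum_(i < n) a i)%N)
  (I := veronese_ideal K d a)
  (sqrtI := radical I)
  (m b : nat)
  (hm : is_max (fun k => exists2 u, mingens sqrtI u & k = max_var u) m)
  (hb : is_max (fun k => exists2 u, mingens sqrtI u & k = mdeg u) b) :
  [/\ equidimensional I <-> cohen_macaulay_ideal sqrtI,
      cohen_macaulay_ideal sqrtI <->
        (forall u : 'X_{1..n},
           (borel_generators sqrtI u /\ mdeg u = b) <->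
           u = interval_monomial n m b) /\
        (forall u : 'X_{1..n},
           mingens sqrtI u -> (max_var u - mdeg u <= m - b)%N) &
      equidimensional I ->
        forall W : {set 'I_n}, minimal_vertex_cover I W ->
          #|W| = (m - b + 1)%N].
Proof.
have hQ : upclosed (threshold d a) by exact: threshold_upclosed.
have sQ : shift_closed (threshold d a) by exact: threshold_shift_closed.
have Q0 : ~~ threshold d a set0 by rewrite /threshold big_set0 -ltnNge.
set Q := threshold d a in hQ sQ Q0.
have rI : forall f, radical I f <-> face_ideal Q f by move=> f; exact: radical_veronese.
have eJ : sqrtI = face_ideal Q by exact: pred_eq.
have shQ := shift_closed_shifted sQ.
have equi := equidimensional_pure hQ rI.
have cmE : cohen_macaulay_ideal sqrtI <-> exists r, pure Q r.
  rewrite eJ; split=> [|[r pQ]]; first exact: cohen_macaulay_pure.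
  exact: (pure_cohen_macaulay K hQ Q0 shQ pQ).
have gensE u : mingens sqrtI u <-> exists2 A, min_nonface Q A & u = set_mnm A.
  by rewrite eJ; exact: mingens_face_ideal.
case: hm => -[_ /gensE[Am hAm ->]]; rewrite max_var_set_mnm => em mmax.
case: hb => -[_ /gensE[Ab hAb ->]]; rewrite mdeg_set_mnm => eb bmax.
have hm' A : min_nonface Q A -> (max_index A <= m)%N.
  move=> hA; apply: mmax; exists (set_mnm A); last by rewrite max_var_set_mnm.
  by apply/gensE; exists A.
have hb' A : min_nonface Q A -> (#|A| <= b)%N.
  move=> hA; apply: bmax; exists (set_mnm A); last by rewrite mdeg_set_mnm.
  by apply/gensE; exists A.
have lt_m A i : min_nonface Q A -> i \in A -> (i < m)%N.
  by move=> hA /max_index_le h; exact: leq_trans h (hm' A hA).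
have eV : interval_monomial n m b = set_mnm (ord_interval n m b).
  by apply/mnmP => i; rewrite !mnmE inE.
have cV := card_interval Q0 hm' hAm (esym em) hAb (esym eb).
split.
- by rewrite equi cmE.
- rewrite cmE; split=> [[r pQ]|[hBor hgap]].
    have hV := pure_interval hQ sQ Q0 hm' hb' hAm (esym em) hAb (esym eb) pQ.
    split=> u; first by rewrite eV eJ; exact: borel_interval.
    move=> /gensE[A hA ->]; rewrite max_var_set_mnm mdeg_set_mnm.
    exact: (pure_gap hQ sQ Q0 hm' hb' hAm (esym em) hAb (esym eb) pQ).
  exists (n - (m - b).+1)%N.
  apply: (interval_pure hQ sQ Q0 hm' hAm (esym em) hAb (esym eb)).
    have [[B [BG _ _] /BG/gensE[A [QA _] e]] _] := (hBor (interval_monomial n m b)).2 erefl.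
    by move/(congr1 (@supp n)): e; rewrite eV !supp_set_mnm => ->.
  move=> A hA; have := hgap (set_mnm A).
  by rewrite max_var_set_mnm mdeg_set_mnm; apply; apply/gensE; exists A.
- move=> /equi[r pQ] W /minimal_vertex_cover_facet/pQ.
  have := pure_codim hQ sQ Q0 hm' hb' hAm (esym em) hAb (esym eb) pQ.
  have := max_card_le Q0 hm' hAm (esym em) hAb (esym eb).
  have := cardsC W; rewrite card_ord; move: #|W| #|~: W| => x y; lia.
Qed.
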